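(* Let $G$ be a $(P_2+P_4,\,K_4-e)$-free graph with $\omega(G)\geq 3$. Then one of the following holds: (i) $G$ is perfect; (ii) if $G$ contains a $C_5$, then either $\chi(G)\leq 6$ or $\chi(G)=\omega(G)$; (iii) if $G$ is $C_5$-free and contains a $C_7$, then $\chi(G)\leq 3$.
   Context: All graphs are finite, simple, undirected. $P_t$ is the chordless path on $t$ vertices, $C_t$ the chordless cycle on $t$ vertices, and $K_4-e$ is $K_4$ minus one edge. $G_1+G_2$ denotes disjoint union. A graph $G$ contains $H$ if $H$ is an induced subgraph of $G$; $G$ is $\mathcal F$-free if it contains no graph of $\mathcal F$. $\chi$ and $\omega$ denote chromatic number and clique number. A graph is perfect if every induced subgraph $H$ satisfies $\chi(H)=\omega(H)$. *)

(* Defs.v *)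
From Stdlib Require List.
From mathcomp Require Import all_boot.

Set Implicit Arguments.
Unset Strict Implicit.
Unset Printing Implicit Defensive.

Record sgraph := SGraph {
  vertex :> finType;
  edge : rel vertex;
  edge_sym : symmetric edge;
  edge_irr : irreflexive edge }.

Lemma path_sym t : symmetric (fun i j : 'I_t => (i.+1 == j) || (j.+1 == i)).
Proof. by move=> i j; rewrite orbC. Qed.

Lemma path_irr t : irreflexive (fun i j : 'I_t => (i.+1 == j) || (j.+1 == i)).
Proof. by move=> i; rewrite orbb; apply/negbTE; rewrite neq_ltn ltnSn orbT. Qed.

Definition path_graph (t : nat) : sgraph :=
  SGraph (@path_sym t) (@path_irr t).

(* The conjunct [i != j] only matters for t = 1; this is the usual cycle for
   t >= 3. *)
Definition cycle_edge (t : nat) (i j : 'I_t) : bool :=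
  (i != j) && ((i.+1 == j %[mod t]) || (j.+1 == i %[mod t])).

Lemma cycle_sym t : symmetric (@cycle_edge t).
Proof. by move=> i j; rewrite /cycle_edge eq_sym orbC. Qed.

Lemma cycle_irr t : irreflexive (@cycle_edge t).
Proof. by move=> i; rewrite /cycle_edge eqxx. Qed.

Definition cycle_graph (t : nat) : sgraph :=
  SGraph (@cycle_sym t) (@cycle_irr t).

Lemma complete_sym n : symmetric (fun i j : 'I_n => i != j).
Proof. by move=> i j; rewrite eq_sym. Qed.

Lemma complete_irr n : irreflexive (fun i j : 'I_n => i != j).
Proof. by move=> i; rewrite eqxx. Qed.

Definition complete_graph (n : nat) : sgraph :=
  SGraph (@complete_sym n) (@complete_irr n).

Section DeleteEdge.
Variables (G : sgraph) (a b : G).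

Definition delete_edge_rel (x y : G) : bool :=
  edge x y && ([set x; y] != [set a; b]).

Lemma delete_edge_sym : symmetric delete_edge_rel.
Proof. by move=> x y; rewrite /delete_edge_rel edge_sym setUC. Qed.

Lemma delete_edge_irr : irreflexive delete_edge_rel.
Proof. by move=> x; rewrite /delete_edge_rel edge_irr. Qed.

Definition delete_edge : sgraph := SGraph delete_edge_sym delete_edge_irr.
End DeleteEdge.

Definition K4_minus_edge : sgraph :=
  @delete_edge (complete_graph 4) (ord0 : 'I_4) (ord_max : 'I_4).

Section DisjointUnion.
Variables G H : sgraph.

Definition dunion_edge (u v : G + H) : bool :=
  match u, v with
  | inl x, inl y => edge x y
  | inr x, inr y => edge x y
  | _, _ => false
  end.

Lemma dunion_sym : symmetric dunion_edge.
Proof. by case=> x [] y //=; rewrite edge_sym. Qed.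

Lemma dunion_irr : irreflexive dunion_edge.
Proof. by case=> x /=; rewrite edge_irr. Qed.

Definition dunion : sgraph := SGraph dunion_sym dunion_irr.
End DisjointUnion.

Section Induced.
Variables (G : sgraph) (S : {set G}).

Definition induced_edge (u v : {x : G | x \in S}) : bool :=
  edge (val u) (val v).

Lemma induced_sym : symmetric induced_edge.
Proof. by move=> u v; apply: edge_sym. Qed.

Lemma induced_irr : irreflexive induced_edge.
Proof. by move=> u; apply: edge_irr. Qed.

Definition induced : sgraph := SGraph induced_sym induced_irr.
End Induced.

Definition isomorphic (G H : sgraph) : Prop :=
  exists f : G -> H, bijective f /\ forall x y, edge (f x) (f y) = edge x y.

Definition contains (G H : sgraph) : Prop :=
  exists S : {set G}, isomorphic H (induced S).

Definition free_of (F : seq sgraph) (G : sgraph) : Prop :=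
  List.Forall (fun H => ~ contains G H) F.

Definition proper_colouring (G : sgraph) (k : nat) (c : {ffun G -> 'I_k}) : bool :=
  [forall x, forall y, edge x y ==> (c x != c y)].

Definition colourable (G : sgraph) (k : nat) : bool :=
  [exists c : {ffun G -> 'I_k}, proper_colouring c].

Lemma ex_colourable (G : sgraph) : exists k, colourable G k.
Proof.
exists #|G|; apply/existsP; exists [ffun x => enum_rank x].
apply/forallP => x; apply/forallP => y; apply/implyP => xy; rewrite !ffunE.
by apply: contraTneq xy => /enum_rank_inj ->; rewrite edge_irr.
Qed.

Definition chi (G : sgraph) : nat := ex_minn (ex_colourable G).

Definition clique (G : sgraph) (S : {set G}) : bool :=
  [forall x in S, forall y in S, (x != y) ==> edge x y].

Definition omega (G : sgraph) : nat := \max_(S : {set G} | clique S) #|S|.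

Definition perfect (G : sgraph) : Prop :=
  forall S : {set G}, chi (induced S) = omega (induced S).

(* Main.v *)
(* Fix a maximum clique K. As G is diamond-free, a vertex outside K has at most
   one neighbour in K, and as G is (P_2 + P_4)-free, every induced P_4 outside K
   meets the neighbourhoods of all vertices of K but at most one.

   If G - K is P_4-free, its components are complete bipartite or unions of
   cliques sharing one vertex, and the colouring of K extends to them: this is a
   list colouring problem where every vertex loses at most one colour. It can
   fail only when |K| = 3, and then there is a C_5. In particular chi = omega
   when omega >= 6.

   If G - K contains a P_4, then K and this P_4 form one of finitely many graphs.
   The other vertices are classified by their neighbours in this base graph, and
   excluding the forbidden subgraphs leaves so few possible classes, and so few
   adjacencies between them, that one can colour every class with one colour;
   this finite verification is carried out by computation.

   In this way C_5-free graphs with omega >= 3 get chi = omega, and the others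
   with omega = 4, 5 get chi <= 6. For omega = 3, one has chi <= 6 since the
   vertices outside K split into three bipartite graphs. Finally, a
   (P_2 + P_4)-free graph without triangles, C_5 and C_7 has no odd hole, hence is
   bipartite, and a C_5-free graph with omega >= 4 has no C_7 since an induced
   P_5 outside K cannot exist. *)

From Stdlib Require List.
Require Import Defs.
From mathcomp Require Import all_boot zify.

Set Implicit Arguments.
Unset Strict Implicit.
Unset Printing Implicit Defensive.

(** * Colouring by classes over a base graph *)

(* Strict triangular adjacency matrix: the row of a vertex lists its adjacencies
   to the later ones, so that consing a vertex to [s] conses a row to [tri s]. *)
Definition bits (G : sgraph) (s : seq G) (x : G) : bitseq :=
  [seq edge x y | y <- s].

Fixpoint tri (G : sgraph) (s : seq G) : seq bitseq :=
  if s is x :: s' then bits s' x :: tri s' else [::].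

Definition avoids (G : sgraph) (F : seq (seq bitseq)) : Prop :=
  forall s : seq G, uniq s -> tri s \notin F.

Definition colourable_on (G : sgraph) (W : {set G}) (k : nat) : Prop :=
  exists c : G -> nat, (forall x, x \in W -> c x < k) /\
    (forall x y, x \in W -> y \in W -> edge x y -> c x <> c y).

(* [if] rather than [&&] and [||], which [vm_compute] evaluates strictly. *)
Fixpoint exi (T : Type) (f : T -> bool) (s : seq T) : bool :=
  if s is x :: s' then if f x then true else exi f s' else false.

Lemma exiP (T : eqType) (f : T -> bool) (s : seq T) :
  reflect (exists2 x, x \in s & f x) (exi f s).
Proof.
suff -> : exi f s = has f s by apply: hasP.
by elim: s => //= x s ->; case: (f x).
Qed.

(** Full symmetric adjacency matrix, with false diagonal, of a triangular one. *)
Fixpoint square (m : seq bitseq) : seq bitseq :=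
  if m is r :: m' then
    (false :: r) :: [seq br.1 :: br.2 | br <- zip r (square m')]
  else [::].

Lemma square_tri (G : sgraph) (s : seq G) :
  square (tri s) = [seq bits s x | x <- s].
Proof.
elim: s => //= x s ->; rewrite /bits /= edge_irr; congr cons.
by rewrite zip_map -map_comp; apply: eq_map => y /=; rewrite edge_sym.
Qed.

(** * Search for induced copies of forbidden graphs *)

Section Embedding.
Variable M : seq bitseq.

Definition adj (i j : nat) : bool := nth false (nth [::] M i) j.

Fixpoint submatrix (p : seq nat) : seq bitseq :=
  if p is i :: p' then [seq adj i j | j <- p'] :: submatrix p' else [::].

Fixpoint same_row (i : nat) (r : bitseq) (img : seq nat) : bool :=
  match r, img with
  | b :: r', j :: img' =>
      if eqn i j then false
      else if (if b then adj i j else ~~ adj i j) then same_row i r' img'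
      else false
  | [::], [::] => true
  | _, _ => false
  end.

(** Backtracking search: [img] holds the vertices placed so far, latest first, and each row of [q]
    gives the adjacencies of the next vertex to those. So [q] is a triangular matrix read backwards,
    whence [catrev] below. *)
Fixpoint embeds (q : seq bitseq) (img : seq nat) : bool :=
  if q is r :: q' then
    exi (fun i => if same_row i r img then embeds q' (i :: img) else false)
        (iota 0 (size M))
  else true.
End Embedding.

Lemma same_rowP M i r img : same_row M i r img ->
  r = [seq adj M i j | j <- img] /\ i \notin img.
Proof.
elim: r img => [|b r IH] [|j img] //=; rewrite eqnE inE.
by case: (i =P j) => // _; case: b; case: (adj M i j) => // /IH[<- ->].
Qed.

Lemma tri_submatrix (G : sgraph) (x0 : G) (s : seq G) p :
  all (fun i => i < size s) p ->
  tri [seq nth x0 s i | i <- p] = submatrix (square (tri s)) p.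
Proof.
elim: p => //= i p IH /andP[hi hp]; rewrite IH //; congr (_ :: _).
rewrite /bits -map_comp; apply/eq_in_map => j /(allP hp) hj /=.
by rewrite /adj square_tri (nth_map x0) // (nth_map x0).
Qed.

Lemma uniq_nths (T : eqType) (x0 : T) (s : seq T) p :
  uniq s -> uniq p -> all (fun i => i < size s) p ->
  uniq [seq nth x0 s i | i <- p].
Proof.
move=> us up hp; rewrite map_inj_in_uniq // => i j /(allP hp) hi /(allP hp) hj.
by move/eqP; rewrite nth_uniq // => /eqP.
Qed.

Lemma embeds_sound (G : sgraph) (x0 : G) (s : seq G) q img :
  uniq s -> uniq img -> all (fun i => i < size s) img ->
  embeds (square (tri s)) q img ->
  exists2 t : seq G, uniq t
    & tri t = catrev q (tri [seq nth x0 s i | i <- img]).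
Proof.
move=> us; elim: q img => [|r q IH] img ui ai /=.
  by move=> _; exists [seq nth x0 s i | i <- img] => //; apply: uniq_nths.
case/exiP=> i; rewrite {1}square_tri size_map mem_iota /= add0n => hi.
case E: same_row => //; case/same_rowP: E => -> ni.
case/IH => /=; [by rewrite ni | by rewrite hi |].
move=> t ut E; exists t => //; rewrite E /=; congr (catrev _ (_ :: _)).
have := @tri_submatrix G x0 s (i :: img); rewrite /= hi => /(_ ai)[-> _].
by [].
Qed.

Fixpoint selections (k : nat) (s : seq nat) : seq (seq nat) :=
  if k is k'.+1 then
    [seq i :: t | t <- selections k' s, i <- [seq i <- s | i \notin t]]
  else [:: [::]].

(* The matrices of [F] reordered in all ways that end with the matrix [root],
   without this end, and reversed. *)
Definition rootings (F : seq (seq bitseq)) (root : seq bitseq) :=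
  undup (flatten [seq
    (let n := size p in let k := size root in
     flatten [seq
       (let o := [seq i <- iota 0 n | i \notin t] ++ t in
        let q := submatrix (square p) o in
        let q' := rev (take (n - k) q) in
        if (catrev q' root == q) && uniq o &&
           (submatrix (square q) [seq index i o | i <- iota 0 n] == p)
        then [:: q'] else [::])
       | t <- selections k (iota 0 n)]) | p <- F]).

(** Only copies using all of [img] are sought: when vertices are added to a graph that occurs, a new
    copy must use them. *)
Definition bad (R : seq (seq bitseq)) (img : seq nat) (m : seq bitseq) : bool :=
  let M := square m in exi (fun q => embeds M q img) R.

Lemma size_tri (G : sgraph) (s : seq G) : size (tri s) = size s.
Proof. by elim: s => //= x s ->. Qed.

Lemma size_submatrix M p : size (submatrix M p) = size p.
Proof. by elim: p => //= i p ->. Qed.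

(** The last test in [rootings] undoes the reordering, so a copy of a reordered matrix becomes,
    after permuting its vertices, a copy of a member of [F]. *)
Lemma bad_sound (G : sgraph) F root (x0 : G) (s : seq G) img :
  avoids G F -> uniq s -> uniq img -> all (fun i => i < size s) img ->
  tri [seq nth x0 s i | i <- img] = root ->
  bad (rootings F root) img (tri s) = false.
Proof.
move=> av us ui ai er; apply/negP => /exiP[q].
rewrite mem_undup => /flattenP[r /mapP[p pF ->] {r}] /=.
case/flattenP=> r /mapP[t _ ->] {r}; case: ifP => //.
set o := _ ++ t; set q1 := submatrix _ o; set q' := rev _.
case/andP=> /andP[/eqP e1 uo] /eqP e2; rewrite inE => /eqP-> {q}.
case/(embeds_sound x0 us ui ai) => t1 ut1; rewrite er e1 => E.
have so : size t1 = size o by rewrite -size_tri E size_submatrix.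
pose o' := [seq index i o | i <- iota 0 (size p)].
have io : {subset iota 0 (size p) <= o}.
  by move=> i hi; rewrite mem_cat mem_filter hi andbT orbC; case: (i \in t).
have := av [seq nth x0 t1 i | i <- o'].
rewrite tri_submatrix; last first.
  by apply/allP=> j /mapP[i /io hi ->]; rewrite so index_mem.
rewrite E e2 pF => /(_ _)/negP; apply=> //.
apply: uniq_nths => //.
  rewrite map_inj_in_uniq ?iota_uniq // => i j /io hi /io hj h.
  by rewrite -(nth_index 0 hi) h nth_index.
by apply/allP=> j /mapP[i /io hi ->]; rewrite so index_mem.
Qed.

(** * Search and verification of colourings *)

Fixpoint all_bits (n : nat) : seq bitseq :=
  if n is n'.+1 then
    [seq false :: t | t <- all_bits n'] ++ [seq true :: t | t <- all_bits n']
  else [:: [::]].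

Lemma mem_all_bits t : t \in all_bits (size t).
Proof.
by elim: t => //= b t IH; rewrite mem_cat; case: b; rewrite map_f ?orbT.
Qed.

Fixpoint try_colours (A : Type) (f : nat -> option A) (k : nat) : option A :=
  if k is k'.+1 then if f k' is Some a then Some a else try_colours f k'
  else None.

(* Backtracking search for a [k]-colouring, always branching on a vertex which
   sees the most colours; [todo] lists the vertices with their neighbours and
   the colours which they see. *)
Fixpoint dsatur (k fuel : nat) (todo : seq (nat * seq nat * seq nat))
    (done : seq (nat * nat)) : option (seq (nat * nat)) :=
  match fuel, todo with
  | fuel'.+1, v0 :: todo' =>
      let v := foldl (fun v u => if size v.2 < size u.2 then u else v)
                     v0 todo' in
      let rest := [seq u <- todo | u.1.1 != v.1.1] in
      try_colours (fun c => if c \in v.2 then None else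
        dsatur k fuel'
          [seq (if ((u.1.1 \in v.1.2) || (v.1.1 \in u.1.2)) && (c \notin u.2)
                then (u.1, c :: u.2) else u) | u <- rest]
          ((v.1.1, c) :: done)) k
  | _, _ => Some done
  end.

(* Row [i] of [rows] tells the adjacency of [i] to [i], [i+1], and so on. *)
Definition find_colouring (k : nat) (rows : seq bitseq) : seq nat :=
  let n := size rows in
  let d := odflt [::] (dsatur k n
    [seq (ir.1, [seq bj.2 | bj <- zip ir.2 (iota ir.1 n) & bj.1], [::])
       | ir <- zip (iota 0 n) rows] [::]) in
  [seq (if [seq p <- d | p.1 == i] is p :: _ then p.2 else k) | i <- iota 0 n].

(** The diagonal is included: a class in conflict with itself could contain an edge, and must make
    [valid_colouring] fail. *)
Fixpoint upper (A : Type) (r : rel A) (s : seq A) : seq bitseq :=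
  if s is x :: s' then [seq r x y | y <- s] :: upper r s' else [::].

(** Certifies the outcome of the unverified search; a vertex left uncoloured carries the colour [k],
    which is rejected. *)
Fixpoint valid_colouring (k : nat) (rows : seq bitseq) (cols : seq nat) : bool :=
  match rows, cols with
  | r :: rows', c :: cols' =>
      [&& c < k, all (fun bd => bd.1 ==> (bd.2 != c)) (zip r cols)
        & valid_colouring k rows' cols']
  | [::], [::] => true
  | _, _ => false
  end.

(** [upper] records each pair in one order only; assuming the relation in both orders spares a proof
    that [r] is symmetric. *)
Lemma valid_colouringP (A : eqType) (r : rel A) k s cols :
  valid_colouring k (upper r s) cols ->
  exists c : A -> nat, (forall x, x \in s -> c x < k) /\
    (forall x y, x \in s -> y \in s -> r x y -> r y x -> c x <> c y).
Proof.
move=> V; exists (fun x => nth 0 cols (index x s)).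
have sz : size cols = size s.
  by elim: s cols V => [|x s IH] [|c cols] //= /and3P[_ _ /IH->].
elim: s cols V sz => [|x s IH] [|c cols] //= /and3P[ck /andP[cx ac] V] [sz].
have [lt ne] := IH _ V sz.
have nc y : y \in s -> r x y -> nth 0 cols (index y s) != c.
  move=> ys rxy; have iy : index y s < size s by rewrite index_mem.
  suff /(allP ac) : (r x y, nth 0 cols (index y s)) \in zip (map (r x) s) cols.
    by rewrite /= rxy.
  have -> : (r x y, nth 0 cols (index y s)) =
            nth (false, 0) (zip (map (r x) s) cols) (index y s).
    by rewrite nth_zip ?size_map // (nth_map x) // nth_index.
  by rewrite mem_nth // size_zip size_map sz minnn.
split=> [y|y z]; rewrite !inE (eq_sym y x) /=; first by case: eqP => //= _ /lt.
rewrite (eq_sym z x); case: eqP => [<-|_] /=.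
  case: eqP => [<- _ _ rx _|_ _ zs rz _] /=.
    by rewrite rx eqxx in cx.
  by apply/eqP; rewrite eq_sym nc.
by case: eqP => [<- ys _ _ rz|_ ys zs] /=; [apply/eqP; rewrite nc | apply: ne].
Qed.

Section Table.
Variables (F : seq (seq bitseq)) (k : nat) (m : seq bitseq).
Variables (sp : seq bitseq) (dropped : seq (bitseq * bool)).

(* Either a vertex of the base graph, or a class of vertices outside of it:
   those with given adjacencies to the base graph; the classes in [sp] are
   split in two according to a boolean, and the classes in [dropped] are assumed
   to be empty. *)
Definition node : Type := (nat + bitseq * bool)%type.

(** Two classes conflict unless an edge between them creates a forbidden graph. The halves of a
    split class are taken to be stable, but in conflict with each other. *)
Definition conflict (R : seq (seq bitseq)) (M : seq bitseq) (u v : node) : bool :=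
  match u, v with
  | inl i, inl j => adj M i j
  | inl i, inr (t, _) => nth false t i
  | inr (t, _), inl i => nth false t i
  | inr (t, p), inr (t', q) =>
      if (t == t') && (t \in sp) then p != q
      else ~~ bad R [:: 0; 1] ((true :: t') :: t :: m)
  end.

Definition classes : seq (bitseq * bool) :=
  let R := rootings F [:: [::]] in
  [seq tp <- [seq (t, false) | t <- [seq t <- all_bits (size m) |
                                     ~~ bad R [:: 0] (t :: m)]]
             ++ [seq (t, true) | t <- sp] | tp \notin dropped].

Definition nodes : seq node :=
  [seq inl i | i <- iota 0 (size m)] ++ [seq inr t | t <- classes].

Definition table : bool :=
  let R := rootings F [:: [:: true]; [::]] in
  let M := square m in
  let rows := upper (conflict R M) nodes in
  valid_colouring k rows (find_colouring k rows).
End Table.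

(** Each vertex takes the colour of its node, [psi] choosing the half of a split class. By
    [bad_sound], nonempty classes are listed and adjacent vertices lie in conflicting nodes. *)
Lemma table_colourable (G : sgraph) F k (s : seq G) sp dropped (psi : G -> bool) :
  avoids G F -> uniq s ->
  (forall x, x \notin s -> (bits s x, psi x) \notin dropped) ->
  (forall x, x \notin s -> psi x -> bits s x \in sp) ->
  (forall x y, x \notin s -> y \notin s -> edge x y ->
     bits s x = bits s y -> bits s x \in sp -> psi x <> psi y) ->
  table F k (tri s) sp dropped ->
  colourable_on [set: G] k.
Proof.
move=> av us hd hp hs /valid_colouringP[c [lt ne]].
pose cls x : node := if x \in s then inl (index x s) else inr (bits s x, psi x).
have nth_bits x y : y \in s -> nth false (bits s x) (index y s) = edge x y.
  by move=> ys; rewrite (nth_map y) ?index_mem // nth_index.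
have mem x : cls x \in nodes F (tri s) sp dropped.
  rewrite mem_cat /cls; case: (boolP (x \in s)) => xs.
    by rewrite map_f // mem_iota size_tri index_mem xs.
  rewrite orbC map_f // mem_filter hd //= mem_cat.
  case E: (psi x); first by rewrite (map_f (fun t => (t, true))) ?hp ?orbT.
  rewrite (map_f (fun t => (t, false))) // mem_filter size_tri.
  have -> : size s = size (bits s x) by rewrite size_map.
  rewrite mem_all_bits andbT; have := @bad_sound G F [:: [::]] x (x :: s) [:: 0] av.
  by rewrite /= xs us /= => ->.
have sym x y : edge x y ->
    conflict (tri s) sp (rootings F [:: [:: true]; [::]])
      (square (tri s)) (cls x) (cls y).
  move=> xy; rewrite /cls /conflict.
  case: (boolP (x \in s)) => xs; case: (boolP (y \in s)) => ys.
  - by rewrite /adj square_tri (nth_map x) ?index_mem // nth_index // nth_bits.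
  - by rewrite nth_bits // edge_sym.
  - by rewrite nth_bits.
  case: ifP => [/andP[/eqP e1 e2]|_]; first by apply/eqP; apply: hs.
  have yx : y != x by apply: contraTneq xy => ->; rewrite edge_irr.
  have := @bad_sound G F [:: [:: true]; [::]] x [:: y, x & s] [:: 0; 1] av.
  by rewrite /= inE negb_or yx xs ys us /= edge_sym xy => ->.
exists (fun x => c (cls x)); split=> [x _|x y _ _ xy]; first exact: lt.
by apply: ne => //; apply: sym; rewrite // edge_sym.
Qed.

(** * Matrices of the graphs used in the computations *)

Definition complete_rows (n : nat) : seq bitseq :=
  [seq nseq i true | i <- rev (iota 0 n)].

(* A path on four vertices followed by K_w; the [i]-th vertex of the path is
   adjacent to the vertex number [l_i] of K_w, counted from 1 (0: to none). *)
Definition pat (w : nat) (l : nat * nat * nat * nat) : seq bitseq :=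
  let: (a, b, c, d) := l in
  let lab x := [seq x == i | i <- iota 1 w] in
  [:: [:: true, false, false & lab a], [:: true, false & lab b],
      true :: lab c, lab d & complete_rows w].

(* An edge uv and a path abcd, in the order v, u, d, a, c, b: the search for copies
   places the middle of the path first. *)
Definition p2p4_rows : seq bitseq :=
  [:: [:: true; false; false; false; false]; [:: false; false; false; false];
      [:: false; true; false]; [:: false; true]; [:: true]; [::]].

Definition diamond_rows : seq bitseq :=
  [:: [:: false; true; true]; [:: true; true]; [:: true]; [::]].

(** The vertices come in the order n-1, ..., 0, so the row of [i] ranges over the smaller [j]. *)
Definition cycle_rows (n : nat) : seq bitseq :=
  rev [seq [seq (j.+1 == i) || ((i.+1 == n) && (j == 0)) | j <- rev (iota 0 i)]
         | i <- iota 0 n].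

(** * P_4-free graphs *)

Definition p4_free_on (G : sgraph) (W : {set G}) : Prop :=
  forall a b c d, a \in W -> b \in W -> c \in W -> d \in W ->
    edge a b -> edge b c -> edge c d -> ~~ edge a c -> ~~ edge b d -> edge a d.

Lemma cliqueP (G : sgraph) (S : {set G}) :
  reflect {in S &, forall x y, x != y -> edge x y} (clique S).
Proof.
apply: (iffP forall_inP) => [h x y xS yS|h x xS].
  by move/forall_inP: (h x xS) => /(_ y yS)/implyP.
by apply/forall_inP=> y yS; apply/implyP; apply: h.
Qed.

Lemma cliqueS (G : sgraph) (S T : {set G}) : S \subset T -> clique T -> clique S.
Proof.
move=> /subsetP st /cliqueP h; apply/cliqueP => x y /st xT /st yT.
exact: h.
Qed.

Lemma cliqueU1 (G : sgraph) (S : {set G}) x :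
  {in S, forall y, edge x y} -> clique S -> clique (x |: S).
Proof.
move=> xS /cliqueP h; apply/cliqueP => y z; rewrite !inE.
case/orP=> [/eqP->|yS] /orP[/eqP->|zS]; rewrite ?eqxx //.
- by move=> _; apply: xS.
- by move=> _; rewrite edge_sym; apply: xS.
- exact: h.
Qed.

Lemma clique1 (G : sgraph) (x : G) : clique [set x].
Proof. by apply/cliqueP => y z; rewrite !inE => /eqP-> /eqP->; rewrite eqxx. Qed.

Lemma p4_free_onS (G : sgraph) (V W : {set G}) :
  V \subset W -> p4_free_on W -> p4_free_on V.
Proof. by move=> /subsetP vw h a b c d /vw aW /vw bW /vw cW /vw dW; apply: h. Qed.

(* In a P_4-free graph every maximal stable set meets every maximal clique. *)
Lemma p4_free_colourable (G : sgraph) (W : {set G}) k :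
  p4_free_on W -> (forall Q : {set G}, Q \subset W -> clique Q -> #|Q| <= k) ->
  colourable_on W k.
Proof.
elim: k W => [|k IH] W p4 om.
  have W0 x : x \in W -> False.
    by move=> xW; have := om [set x]; rewrite sub1set xW cards1 clique1 => /(_ isT isT).
  by exists (fun=> 0); split=> [x|x y] /W0.
pose stable (S : {set G}) :=
  (S \subset W) && [forall x in S, forall y in S, ~~ edge x y].
have [|S /maxsetP[/andP[SW stS] maxS]] := @ex_maxset _ stable.
  by exists set0; rewrite /stable sub0set; apply/forall_inP=> x; rewrite inE.
have st x y : x \in S -> y \in S -> ~~ edge x y.
  by move=> xS yS; move/forall_inP: stS => /(_ x xS)/forall_inP/(_ y yS).
have dom x : x \in W -> x \notin S -> exists2 s, s \in S & edge x s.
  move=> xW xS; case: (boolP [exists s in S, edge x s]) => [/exists_inP//|].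
  rewrite negb_exists_in => /forall_inP nx.
  have : x |: S = S.
    apply: maxS; rewrite ?subsetUr // /stable subUset sub1set xW SW /=.
    apply/forall_inP => y; rewrite !inE => yS; apply/forall_inP => z.
    rewrite !inE; case/orP: yS => [/eqP->|yS] /orP[/eqP->|zS];
      rewrite ?edge_irr //; [exact: nx | rewrite edge_sym; exact: nx | exact: st].
  by move=> E; move: xS; rewrite -E !inE eqxx.
have [c [ck cc]] : colourable_on (W :\: S) k.
  apply: IH => [|Q QW clQ].
    by apply: p4_free_onS p4; apply: subsetDl.
  have QW' : Q \subset W by apply: subset_trans QW (subsetDl _ _).
  have QS q : q \in Q -> q \notin S by move/(subsetP QW); rewrite inE => /andP[].
  rewrite leqNgt; apply/negP => ltk.
  have /card_gt0P[q0 q0Q] : 0 < #|Q| by apply: leq_ltn_trans ltk.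
  have [s0 s0S _] := dom q0 (subsetP QW' _ q0Q) (QS _ q0Q).
  (* A vertex s of S with most neighbours in Q sees all of Q: if it misses q, then some s' in S sees
     q, and also every q' seen by s, since s q' q s' is not an induced P_4. *)
  case: (@arg_maxnP _ s0 (mem S) (fun s => #|[set q in Q | edge s q]|) s0S).
  move=> s sS smax.
  have full : {in Q, forall q, edge s q}.
    move=> q qQ; apply/negPn/negP => nsq.
    have [s' s'S qs'] := dom q (subsetP QW' _ qQ) (QS _ qQ).
    have : #|[set q in Q | edge s' q]| <= #|[set q in Q | edge s q]| := smax s' s'S.
    rewrite leqNgt => /negP; apply; apply: proper_card.
    apply/properP; split; last first.
      by exists q; rewrite !inE qQ ?(negbTE nsq) // edge_sym.
    apply/subsetP => q'; rewrite !inE => /andP[q'Q sq']; rewrite q'Q /=.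
    apply/negPn/negP => nq's'; have /negP := st _ _ sS s'S; apply.
    apply: (p4 s q' q s') => //; last by rewrite edge_sym.
    - exact: (subsetP SW).
    - exact: (subsetP QW').
    - exact: (subsetP QW').
    - exact: (subsetP SW).
    - by apply: (cliqueP _ clQ) => //; apply: contraNneq nsq => <-.
  have : #|s |: Q| <= k.+1.
    apply: om; first by rewrite subUset sub1set (subsetP SW).
    exact: cliqueU1.
  by rewrite cardsU1 (contraL (QS s)) //= add1n ltnS leqNgt ltk.
exists (fun x => if x \in S then k else c x); split=> [x xW|x y xW yW xy].
  case: ifP => // xS; apply: leqW; apply: ck; by rewrite inE xS.
case: ifP => xS; case: ifP => yS.
- by case/negP: (st _ _ xS yS).
- by move=> E; have := ck y; rewrite -E inE yS yW ltnn => /(_ isT).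
- by move=> E; have := ck x; rewrite E inE xS xW ltnn => /(_ isT).
- by apply: cc; rewrite // inE ?xS ?yS.
Qed.

(** * Bipartite graphs *)

Section Walks.
Variable G : sgraph.
Implicit Types x y z : G.

Fixpoint walk (n : nat) x y : bool :=
  if n is n'.+1 then [exists z, edge x z && walk n' z y] else x == y.

Lemma walk1 x y : edge x y -> walk 1 x y.
Proof. by move=> xy; apply/existsP; exists y; rewrite xy /=. Qed.

Lemma walk_cat m n x y z : walk m x y -> walk n y z -> walk (m + n) x z.
Proof.
elim: m x => [|m IH] x /=; first by move/eqP->.
move=> /existsP[u /andP[xu uy]] yz; apply/existsP; exists u.
by rewrite xu IH.
Qed.

Lemma walkP n x y : walk n x y ->
  exists c : nat -> G, [/\ c 0 = x, c n = y & forall i, i < n -> edge (c i) (c i.+1)].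
Proof.
elim: n x => [|n IH] x /=; first by move/eqP->; exists (fun=> y).
case/existsP=> z /andP[xz /IH[c [c0 cn cE]]].
exists (fun i => if i is i'.+1 then c i' else x).
by split=> // -[|i] //= lt; rewrite ?c0 //; apply: cE.
Qed.

Lemma subwalk (c : nat -> G) n i j :
  (forall i, i < n -> edge (c i) (c i.+1)) -> i <= j -> j <= n ->
  walk (j - i) (c i) (c j).
Proof.
move=> cE ij jn; rewrite -{2}(subnKC ij); have : i + (j - i) <= n by lia.
elim: (j - i) => [|k IH] lt; first by rewrite addn0 /=.
rewrite -addn1 addnA; apply: walk_cat (IH _) (walk1 _); first by lia.
by rewrite addn1; apply: cE; lia.
Qed.

(** The bipartite double cover. *)
Let cover : rel (G * bool) := fun p q => edge p.1 q.1 && (p.2 != q.2).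

Let cover_sym : symmetric cover.
Proof. by move=> [x b] [y b']; rewrite /cover edge_sym eq_sym. Qed.

Let edge_csym : connect_sym (@edge G).
Proof. by apply: sym_connect_sym => x y; apply: edge_sym. Qed.

(** The two lifts of a vertex lie in different components of the double cover, for a path between
    them projects to an odd closed walk. The colour of x tells which lift of x is connected to a
    fixed lift of the root of its component. *)
Lemma no_odd_closed_walk_colourable :
  (forall n x, odd n -> ~~ walk n x x) -> colourable_on [set: G] 2.
Proof.
move=> odd_free.
have project p q : connect cover p q ->
    exists2 n, odd n = (p.2 != q.2) & walk n p.1 q.1.
  case/connectP=> s; elim: s p => [|u s IH] p /=.
    by move=> _ ->; exists 0; rewrite /= ?eqxx.
  case/andP=> /andP[pu bpu] us /(IH _ us)[n on wn]; exists n.+1.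
    by move: bpu on; rewrite /=; case: (p.2); case: (q.2); case: (u.2); case: odd.
  by apply/existsP; exists u.1; rewrite pu.
have lift x y b : connect (@edge G) x y -> exists b', connect cover (x, b) (y, b').
  case/connectP=> s; elim: s x b => [|u s IH] x b /=.
    by move=> _ ->; exists b; apply: connect0.
  case/andP=> xu us /(IH _ (~~ b) us)[b' ub']; exists b'.
  apply: connect_trans ub'; apply: connect1; rewrite /cover /= xu.
  by case: b.
pose col x := connect cover (root (@edge G) x, false) (x, true).
exists (fun x => nat_of_bool (col x)); split=> [x _|x y _ _ xy]; first by case: col.
have rE : root (@edge G) x = root (@edge G) y.
  by apply/eqP; rewrite root_connect //; apply: connect1.
have step b : cover (x, b) (y, ~~ b) by rewrite /cover /= xy; case: b.
case Ex: (col x); case Ey: (col y) => // _.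
  have cyx : connect cover (y, false) (y, true).
    apply: (@connect_trans _ _ (root (@edge G) y, false)); last exact: Ey.
    rewrite (sym_connect_sym cover_sym) -rE.
    by apply: connect_trans Ex (connect1 (step true)).
  by have [n /= on] := project _ _ cyx; apply/negP/odd_free.
have [|[] cx] := @lift (root (@edge G) x) x false.
- by rewrite edge_csym; apply: connect_root.
- by rewrite /col cx in Ex.
move: Ey; rewrite /col -rE.
by rewrite (connect_trans cx (connect1 (step false))).
Qed.

(* A shortest odd closed walk is an induced cycle, which contains P_2 + P_4 if it
   has at least nine vertices. *)
Lemma bipartite :
  avoids G [:: p2p4_rows; cycle_rows 3; cycle_rows 5; cycle_rows 7] ->
  colourable_on [set: G] 2.
Proof.
move=> av; apply: no_odd_closed_walk_colourable => n0 x0 on0; apply/negP => w0.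
have ex : exists n, odd n && [exists x, walk n x x].
  by exists n0; rewrite on0; apply/existsP; exists x0.
case: (ex_minnP ex) => n /andP[on /existsP[x /walkP[c [c0 cn cE]]]] nmin.
have short k y : odd k -> walk k y y -> n <= k.
  by move=> ok wk; apply: nmin; rewrite ok; apply/existsP; exists y.
have sub i j := @subwalk c n i j cE.
have loop i j : i <= j -> j <= n -> walk (n - j + i) (c j) (c i).
  move=> ij jn; apply: (@walk_cat _ _ _ (c n)); first exact: sub.
  by rewrite cn -c0 -{1}(subn0 i); apply: sub; lia.
(* A repeated vertex, or below a chord, splits the closed walk into two; one of them is odd and
   shorter than n. *)
have inj i j : i < j -> j < n -> c i != c j.
  move=> ij jn; apply/eqP => e; case oij: (odd (j - i)).
    have := short (j - i) (c i) oij; rewrite {2}e sub; last first => //; try lia.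
  have := short (n - j + i) (c i) _; rewrite {1}e loop //; try lia.
have edgeE i j : j < i -> i < n ->
    edge (c i) (c j) = (j.+1 == i) || ((i.+1 == n) && (j == 0)).
  move=> ji lt; apply/idP/idP => [e|]; last first.
    case/orP=> [/eqP<-|/andP[/eqP ei /eqP->]]; first by rewrite edge_sym cE //; lia.
    by rewrite c0 -cn -ei cE // ei.
  case oij: (odd (i - j)).
    have := short (n - i + j + 1) (c i) _;
      rewrite (walk_cat (loop _ _ _ _)) //; try lia.
    by apply: walk1; rewrite edge_sym.
  have := short (i - j + 1) (c j) _; rewrite (walk_cat (sub _ _ _ _)) //; try lia.
  exact: walk1.
have nu p : uniq p -> all (gtn n) p -> uniq [seq c i | i <- p].
  move=> up /allP hp; rewrite map_inj_in_uniq // => i j /hp hi /hp hj e.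
  by case: (ltngtP i j) => // h; [have := inj i j h hj | have := inj j i h hi];
    rewrite e eqxx.
have := av [seq c i | i <- rev (iota 0 n)].
rewrite nu ?rev_uniq ?iota_uniq //; last first.
  by apply/allP=> i; rewrite mem_rev mem_iota.
move=> /(_ isT); case: (ltnP n 8) => [n8|n8 _].
  have : n \in [:: 1; 3; 5; 7] by move: n8 on; clear; do 8![case: n => [|n] //].
  rewrite !inE => /or4P[] /eqP E; subst n; rewrite /= /bits /= ?edgeE // => _.
  by have := cE 0 isT; rewrite c0 cn edge_irr.
have edgeE' i j : i < n -> j < n -> edge (c i) (c j) =
    [|| i.+1 == j, j.+1 == i, (j.+1 == n) && (i == 0) | (i.+1 == n) && (j == 0)].
  move=> hi hj; case: (ltngtP i j) => ij; last by rewrite ij edge_irr; lia.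
    by rewrite edge_sym edgeE //; lia.
  by rewrite edgeE //; lia.
(* The edge 0 1 and the path 3 4 5 6 of a long cycle, in the order of [p2p4_rows]. *)
have := nu [:: 1; 0; 6; 3; 5; 4] isT; rewrite /= !(ltn_trans _ n8) //.
move=> /(_ isT) us; have := av [:: c 1; c 0; c 6; c 3; c 5; c 4] us.
rewrite /= /bits /= !edgeE' ?(ltn_trans _ n8) //.
by move: n8; clear; do 8![case: n => [|n] //].
Qed.
End Walks.

(** * Extending the colouring of a clique *)

Ltac rewrite_edges :=
  repeat match goal with
  | H : is_true (edge ?x ?y) |- context [edge ?x ?y] => rewrite H
  | H : is_true (edge ?x ?y) |- context [edge ?y ?x] => rewrite (edge_sym y x) H
  | H : is_true (~~ edge ?x ?y) |- context [edge ?x ?y] => rewrite (negbTE H)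
  | H : is_true (~~ edge ?x ?y) |- context [edge ?y ?x] =>
      rewrite (edge_sym y x) (negbTE H)
  end.

(* Two vertices differ when some vertex is adjacent to exactly one of them. *)
Ltac distinct_vertices :=
  rewrite /= ?inE ?negb_or ?andbT;
  repeat (apply/andP; split); apply/eqP => E; subst;
  repeat match goal with
  | H : is_true (edge ?x ?x) |- _ => by rewrite edge_irr in H
  | H : is_true (edge ?x ?y), H' : is_true (~~ edge ?x ?y) |- _ =>
      by rewrite H in H'
  | H : is_true (edge ?x ?y), H' : is_true (~~ edge ?y ?x) |- _ =>
      by rewrite edge_sym H in H'
  end.

Lemma avoids_diamond (G : sgraph) (a b x y : G) :
  avoids G [:: diamond_rows] -> edge a b -> edge a x -> edge b x ->
  edge a y -> edge b y -> x != y -> edge x y.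
Proof.
move=> av ab ax bx ay bY xy; apply/negPn/negP => nxy.
have us : uniq [:: y; x; b; a].
  rewrite /= inE negb_or (eq_sym y) xy /=; distinct_vertices.
by have := av _ us; rewrite /= /bits /=; rewrite_edges.
Qed.

Lemma avoids_p2p4 (G : sgraph) (u v a b c d : G) :
  avoids G [:: p2p4_rows] -> edge u v -> edge a b -> edge b c -> edge c d ->
  ~~ edge a c -> ~~ edge a d -> ~~ edge b d ->
  ~~ edge u a -> ~~ edge u b -> ~~ edge u c -> ~~ edge u d ->
  ~~ edge v a -> ~~ edge v b -> ~~ edge v c -> ~~ edge v d -> False.
Proof.
move=> av *; have us : uniq [:: v; u; d; a; c; b] by distinct_vertices.
by have := av _ us; rewrite /= /bits /=; rewrite_edges.
Qed.

Lemma avoids_c5 (G : sgraph) (a b c d f : G) :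
  avoids G [:: cycle_rows 5] -> edge a b -> edge b c -> edge c d -> edge d f ->
  edge f a -> ~~ edge a c -> ~~ edge a d -> ~~ edge b d -> ~~ edge b f ->
  ~~ edge c f -> False.
Proof.
move=> av *; have us : uniq [:: f; d; c; b; a] by distinct_vertices.
by have := av _ us; rewrite /= /bits /=; rewrite_edges.
Qed.

Section ListColouring.
Variables (G : sgraph) (w : nat) (K : {set G}).
Hypotheses (dia : avoids G [:: diamond_rows]) (clK : clique K) (cK : #|K| = w)
  (w3 : 3 <= w) (omw : forall S : {set G}, clique S -> #|S| <= w).

(** A vertex with two neighbours in K would see all of K, by diamond-freeness, and enlarge it. *)
Lemma neighbour_in_clique v i j :
  v \notin K -> i \in K -> j \in K -> edge v i -> edge v j -> i = j.
Proof.
move=> vK iK jK vi vj; apply/eqP/negPn/negP => ij.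
have all_nb : {in K, forall l, edge v l}.
  move=> l lK; case: (eqVneq l i) => [->//|li]; case: (eqVneq l j) => [->//|lj].
  apply: (avoids_diamond dia (a := i) (b := j));
    rewrite 1?(edge_sym i v) 1?(edge_sym j v) //;
    try by apply: (cliqueP _ clK); rewrite // eq_sym.
  by apply: contraNneq vK => ->.
by have := omw (cliqueU1 all_nb clK); rewrite cardsU1 vK cK ltnn.
Qed.

(** The vertices of K serve as colours, and a vertex may not take a colour it sees. As it sees at
    most one, Hall's condition can fail only if Q and L have equal size and all of Q sees the same
    colour, which the last hypothesis excludes. *)
Lemma clique_list_colouring (Q L : {set G}) :
  Q \subset ~: K -> L \subset K -> #|Q| <= #|L| ->
  (#|Q| = #|L| -> forall j, j \in L -> forall u, u \in Q ->
     exists2 v, v \in Q & ~~ edge v j) ->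
  exists c : G -> G, {in Q, forall x, c x \in L /\ ~~ edge x (c x)} /\
    {in Q &, injective c}.
Proof.
elim: {Q}_.+1 {-2}Q (ltnSn #|Q|) L => // n IH Q szQ L QK LK QL hall.
have notK v : v \in Q -> v \notin K by move/(subsetP QK); rewrite inE.
case: (set_0Vmem Q) => [->|[v0 v0Q]].
  by exists id; split=> x; rewrite inE.
suff [v [j [vQ jL vj rest]]] : exists v j, [/\ v \in Q, j \in L, ~~ edge v j &
    #|Q| = #|L| -> forall j', j' \in L :\ j -> forall u, u \in Q :\ v ->
     exists2 v', v' \in Q :\ v & ~~ edge v' j'].
  have cQ := cardsD1 v Q; have cL := cardsD1 j L; rewrite vQ in cQ; rewrite jL in cL.
  have [|||||c [cL' ci]] := IH (Q :\ v) _ (L :\ j); try lia.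
  - by apply: subset_trans QK; apply: subsetDl.
  - by apply: subset_trans LK; apply: subsetDl.
  - by move=> e; apply: rest; lia.
  exists (fun x => if x == v then j else c x); split=> [x xQ|x y xQ yQ].
    case: eqP => [->//|/eqP xv]; have [|] := cL' x; first by rewrite !inE xv.
    by rewrite !inE => /andP[].
  have cj z : z \in Q -> z != v -> c z != j.
    by move=> zQ zv; have [|] := cL' z; rewrite !inE ?zv // => /andP[].
  case: eqP => [->|/eqP xv]; case: eqP => [->|/eqP yv] //.
  - by move=> e; have := cj y yQ yv; rewrite e eqxx.
  - by move=> e; have := cj x xQ xv; rewrite e eqxx.
  - by apply: ci; rewrite !inE ?xv ?yv.
have [eQL|neQL] := eqVneq #|Q| #|L|; last first.
  have /card_gt1P[j1 [j2 [j1L j2L j12]]] : 1 < #|L|.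
    have : 0 < #|Q| by apply/card_gt0P; exists v0.
    by lia.
  case: (boolP (edge v0 j1)) => v1; last first.
    by exists v0, j1; split=> // /eqP; rewrite (negbTE neQL).
  exists v0, j2; split=> //; last by move/eqP; rewrite (negbTE neQL).
  apply: contra j12 => v2; apply/eqP.
  by apply: (neighbour_in_clique (notK _ v0Q)); rewrite ?(subsetP LK).
(* If u sees j, give j to a vertex missing it: u remains, and misses every other colour. *)
case: (boolP [exists j in L, exists u in Q, edge u j]) => [|none].
  case/exists_inP=> j jL /exists_inP[u uQ uj].
  have [v vQ vj] := hall eQL j jL u uQ.
  exists v, j; split=> // _ j'; rewrite !inE => /andP[j'j j'L] _ _.
  exists u; first by rewrite !inE uQ andbT; apply: contraNneq vj => <-.
  apply: contra j'j => uj'; apply/eqP.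
  by apply: (neighbour_in_clique (notK _ uQ)); rewrite ?(subsetP LK).
have none' v j : v \in Q -> j \in L -> ~~ edge v j.
  by move=> vQ jL; apply: contra none => vj; apply/exists_inP; exists j => //;
    apply/exists_inP; exists v.
have /card_gt0P[j jL] : 0 < #|L| by rewrite -eQL; apply/card_gt0P; exists v0.
exists v0, j; split=> //; first exact: none'.
move=> _ j' j'L u uQ; exists u => //; apply: none'.
  by move: uQ; rewrite inE => /andP[].
by move: j'L; rewrite inE => /andP[].
Qed.

Definition list_colourable (W L : {set G}) :=
  exists c : G -> G, {in W, forall x, c x \in L /\ ~~ edge x (c x)} /\
    {in W &, forall x y, edge x y -> c x <> c y}.

Lemma list_colourableU (V W L : {set G}) :
  {in V & W, forall x y, ~~ edge x y} ->
  list_colourable V L -> list_colourable W L -> list_colourable (V :|: W) L.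
Proof.
move=> vw [c [cL cE]] [d [dL dE]].
exists (fun x => if x \in V then c x else d x); split=> [x|x y]; rewrite !inE.
  by case: ifP => [xV _|_ /= xW]; [apply: cL | apply: dL].
case: ifP => xV; case: ifP => yV //= xW yW xy.
- exact: cE.
- by case/negP: (vw _ _ xV yW).
- by case/negP: (vw _ _ yV xW); rewrite edge_sym.
- exact: dE.
Qed.

(* A neighbourhood is a union of cliques, which extend to larger cliques by the
   common neighbour [y]; hence Hall's condition holds for each of them. *)
Lemma neighbourhood_list_colouring y i (W : {set G}) :
  y \notin K -> i \in K -> W \subset ~: K -> {in W, forall x, edge y x} ->
  list_colourable W (K :\ i).
Proof.
move=> yK iK; elim: {W}_.+1 {-2}W (ltnSn #|W|) => // n IH W szW WK yW.
case: (set_0Vmem W) => [->|[v vW]].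
  by exists id; split=> x; rewrite inE.
pose Q := [set x in W | (x == v) || edge v x].
have QW : Q \subset W by apply/subsetP=> x; rewrite inE => /andP[].
have clQ : clique Q.
  apply/cliqueP=> a b; rewrite !inE => /andP[aW av] /andP[bW bv] ab.
  case/orP: av => [/eqP ea|va]; case/orP: bv => [/eqP eb|vb].
  - by rewrite ea eb eqxx in ab.
  - by rewrite ea.
  - by rewrite eb edge_sym.
  by apply: (avoids_diamond dia (a := y) (b := v)); rewrite ?yW.
have ltQ : #|Q| < w.
  have := omw (cliqueU1 (fun x xQ => yW x (subsetP QW x xQ)) clQ).
  rewrite cardsU1; case: (boolP (y \in Q)) => // /(subsetP QW)/yW.
  by rewrite edge_irr.
have cKi : #|K :\ i| = w.-1 by rewrite -cK (cardsD1 i K) iK.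
have -> : W = Q :|: (W :\: Q).
  by apply/setP=> x; rewrite !inE; case: (x \in W); case: (x == v); case: (edge v x).
apply: list_colourableU.
- move=> x z xQ; rewrite 2!inE negb_and => /andP[zQ zW]; move: zQ; rewrite zW /=.
  rewrite negb_or => /andP[zv vz]; apply: contra vz => xz.
  move: xQ; rewrite inE => /andP[xW /orP[/eqP<-//|vx]].
  apply: (avoids_diamond dia (a := y) (b := x)); rewrite ?yW //.
    by rewrite edge_sym.
  by rewrite eq_sym.
- have [|||c [cL ci]] := @clique_list_colouring Q (K :\ i) _ (subsetDl _ _).
  + exact: subset_trans WK.
  + by rewrite cKi; lia.
  + rewrite cKi => eQ j; rewrite !inE => /andP[ji jK] u uQ.
    (* If all of Q saw j, so would y, and y, j and Q would form a clique of size w + 1. *)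
    apply/exists_inP; rewrite -negb_forall_in; apply/negP => /forall_inP full.
    have jQ : {in Q, forall x, edge j x} by move=> x xQ; rewrite edge_sym full.
    have /card_gt1P[q1 [q2 [q1Q q2Q q12]]] : 1 < #|Q| by lia.
    have yj : y != j by apply: contraNneq yK => ->.
    have eyj : edge y j.
      apply: (avoids_diamond dia (a := q1) (b := q2)) => //.
      * exact: (cliqueP _ clQ).
      * by rewrite edge_sym yW // (subsetP QW).
      * by rewrite edge_sym yW // (subsetP QW).
      * exact: full.
      * exact: full.
    have clj := cliqueU1 jQ clQ.
    have clyj : clique (y |: (j |: Q)).
      apply: cliqueU1 clj => x; rewrite !inE => /orP[/eqP->//|/andP[xW _]].
      exact: yW.
    have := omw clyj; rewrite !cardsU1 !inE negb_or yj /=.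
    have -> : (y \in W) = false.
      by apply/negP => /yW; rewrite edge_irr.
    have -> : (j \in W) = false.
      by apply/negP => /(subsetP WK); rewrite inE jK.
    by rewrite /= eQ !add1n prednK ?ltnn // (leq_trans _ w3).
  exists c; split=> // x z xQ zQ xz /(ci _ _ xQ zQ) e.
  by rewrite e edge_irr in xz.
apply: IH; last by move=> x; rewrite inE => /andP[_ /yW].
  have : #|W :\: Q| < #|W|; last by lia.
  apply/proper_card/properP; split; first exact: subsetDl.
  by exists v => //; rewrite !inE vW eqxx.
by apply: subset_trans WK; apply: subsetDl.
Qed.

Lemma other_colours (i j : G) : exists2 l, l \in K & (l != i) && (l != j).
Proof.
have : 0 < #|K :\ i :\ j|.
  have := cardsD1 i K; have := cardsD1 j (K :\ i).
  by rewrite cK; case: (_ \in _); case: (_ \in _) => /=; move: w3; lia.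
by case/card_gt0P=> l; rewrite !inE => /and3P[lj li lK]; exists l; rewrite ?li.
Qed.

(** The centre takes a colour i that it misses, and its neighbours use the others. *)
Lemma windmill_list_colouring y (W : {set G}) :
  y \notin K -> W \subset ~: K -> {in W, forall x, edge y x} ->
  list_colourable (y |: W) K.
Proof.
move=> yK WK yW.
have [i iK yi] : exists2 i, i \in K & ~~ edge y i.
  have [i iK _] := other_colours y y; case: (boolP (edge y i)) => yi; last by exists i.
  have [j jK /andP[ji _]] := other_colours i i; exists j => //.
  by apply: contra ji => yj; apply/eqP; apply: neighbour_in_clique yj yi.
have [c [cL cE]] := neighbourhood_list_colouring yK iK WK yW.
exists (fun x => if x == y then i else c x); split=> [x|x z]; rewrite !inE.
  by case: eqP => [->//|_ /= /cL[]]; rewrite inE => /andP[].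
case: eqP => [->|_]; case: eqP => [->|_] /=.
- by rewrite edge_irr.
- by move=> _ /cL[]; rewrite !inE => /andP[ci _] _ _ e; rewrite -e eqxx in ci.
- by move=> /cL[]; rewrite !inE => /andP[ci _] _ _ _ e; rewrite e eqxx in ci.
- exact: cE.
Qed.

Section Biclique.
Variables X Y : {set G}.
Hypotheses (XK : X \subset ~: K) (YK : Y \subset ~: K)
  (stX : {in X &, forall x y, ~~ edge x y}) (stY : {in Y &, forall x y, ~~ edge x y}).

Lemma biclique_two_colours (f g : G -> G) :
  {in X, forall x, f x \in K /\ ~~ edge x (f x)} ->
  {in Y, forall x, g x \in K /\ ~~ edge x (g x)} ->
  (forall x y, x \in X -> y \in Y -> f x != g y) ->
  list_colourable (X :|: Y) K.
Proof.
move=> fK gK fg; exists (fun x => if x \in X then f x else g x).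
split=> [x|x y]; rewrite !inE.
  by case: ifP => [xX _|_ /= xY]; [apply: fK | apply: gK].
case: ifP => xX; case: ifP => yX //= xY yY xy; apply/eqP.
- by case/negP: (stX xX yX).
- exact: fg.
- by rewrite eq_sym fg.
- by case/negP: (stY xY yY).
Qed.

(** Each side is given two colours of its own, and every vertex misses one of them. *)
Lemma biclique_list_colouring4 : 4 <= w -> list_colourable (X :|: Y) K.
Proof.
rewrite -cK cardE => w4; have : uniq (enum K) := enum_uniq _.
have : {subset enum K <= K} by move=> x; rewrite mem_enum.
case: (enum K) w4 => [|p [|q [|r [|t l]]]] //= _ sub.
rewrite !inE !negb_or => /and4P[/and4P[pq pr pt _] /and3P[qr qt _] /andP[rt _] _].
have [pK qK rK tK] : [/\ p \in K, q \in K, r \in K & t \in K].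
  by split; apply: sub; rewrite !inE eqxx ?orbT.
have avoid a b x : a \in K -> b \in K -> a != b -> x \notin K -> edge x a ->
    ~~ edge x b.
  move=> aK bK ab xK xa; apply: contra ab => xb.
  by apply/eqP; apply: neighbour_in_clique xa xb.
apply: (@biclique_two_colours (fun x => if edge x p then q else p)
                              (fun x => if edge x r then t else r)).
- move=> x /(subsetP XK); rewrite inE => xK; case: ifP => [xp|->] //.
  by split=> //; apply: avoid xp.
- move=> x /(subsetP YK); rewrite inE => xK; case: ifP => [xp|->] //.
  by split=> //; apply: avoid xp.
- by move=> x y _ _; case: ifP => _; case: ifP => _.
Qed.
End Biclique.

(** If x and x' in X see distinct colours a and b, every y in Y sees a or b, else x y x' b a is an
    induced C_5. As y sees only one colour, no vertex of X sees a third colour l; so X takes l, and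
    Y takes i or j. *)
Lemma biclique_two_labels (X Y : {set G}) x1 x2 i j :
  avoids G [:: cycle_rows 5] ->
  X \subset ~: K -> Y \subset ~: K ->
  {in X &, forall x y, ~~ edge x y} -> {in Y &, forall x y, ~~ edge x y} ->
  {in X & Y, forall x y, edge x y} ->
  (exists y, y \in Y) -> x1 \in X -> x2 \in X -> i \in K -> j \in K -> i != j ->
  edge x1 i -> edge x2 j -> list_colourable (X :|: Y) K.
Proof.
move=> c5 XK YK stX stY XY [y0 y0Y] x1X x2X iK jK ij x1i x2j.
have nX x : x \in X -> x \notin K by move/(subsetP XK); rewrite inE.
have nY x : x \in Y -> x \notin K by move/(subsetP YK); rewrite inE.
have nb x a b : x \notin K -> a \in K -> b \in K -> a != b -> edge x a ->
    ~~ edge x b.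
  move=> xK aK bK ab xa; apply: contra ab => xb.
  by apply/eqP; apply: neighbour_in_clique xa xb.
have claim x x' a b y : x \in X -> x' \in X -> a \in K -> b \in K -> a != b ->
    edge x a -> edge x' b -> y \in Y -> edge y a || edge y b.
  move=> xX x'X aK bK ab xa x'b yY; apply/negPn/negP; rewrite negb_or => /andP[ya yb].
  apply: (avoids_c5 c5 (a := x) (b := y) (c := x') (d := b) (f := a)) => //.
  - exact: XY.
  - by rewrite edge_sym XY.
  - by apply: (cliqueP _ clK); rewrite // eq_sym.
  - by rewrite edge_sym.
  - exact: stX.
  - by apply: (nb _ a); rewrite ?nX.
  - by apply: (nb _ b); rewrite ?nX // eq_sym.
have [l lK /andP[li lj]] := other_colours i j.
apply: (@biclique_two_colours _ _ stX stY (fun=> l)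
  (fun y => if edge y i then j else i)).
- move=> x xX; split=> //; apply/negP => xl.
  have y0K := nY _ y0Y.
  have c1 := claim _ _ _ _ _ x1X x2X iK jK ij x1i x2j y0Y.
  have c2 := claim _ _ _ _ _ xX x1X lK iK li xl x1i y0Y.
  have c3 := claim _ _ _ _ _ xX x2X lK jK lj xl x2j y0Y.
  have /implyP n1 := nb y0 i j y0K iK jK ij.
  have /implyP n2 := nb y0 l i y0K lK iK li.
  have /implyP n3 := nb y0 l j y0K lK jK lj.
  move: c1 c2 c3 n1 n2 n3.
  by case: (edge y0 i); case: (edge y0 j); case: (edge y0 l).
- move=> y yY; case: ifP => [yi|->] //; split=> //; by apply: (nb _ i); rewrite ?nY.
- by move=> x y _ _; case: ifP.
Qed.

(** If neither side sees two colours, each side gets a single colour, unseen by it. *)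
Lemma biclique_list_colouring (X Y : {set G}) :
  4 <= w \/ avoids G [:: cycle_rows 5] ->
  X \subset ~: K -> Y \subset ~: K ->
  {in X &, forall x y, ~~ edge x y} -> {in Y &, forall x y, ~~ edge x y} ->
  {in X & Y, forall x y, edge x y} ->
  (exists x, x \in X) -> (exists y, y \in Y) -> list_colourable (X :|: Y) K.
Proof.
move=> [w4|c5] XK YK stX stY XY X0 Y0; first exact: biclique_list_colouring4.
pose two (Z : {set G}) := [exists x1 in Z, exists x2 in Z, exists i in K,
  exists j in K, [&& i != j, edge x1 i & edge x2 j]].
have one (Z : {set G}) : ~~ two Z ->
    exists a, {in Z, forall x, {in K, forall i, edge x i -> i = a}}.
  move=> nZ; case: (boolP [exists x in Z, exists i in K, edge x i]).
    case/exists_inP=> x xZ /exists_inP[a aK xa]; exists a => z zZ i iK zi.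
    apply/eqP; apply: contraNT nZ => ia; apply/exists_inP; exists z => //.
    apply/exists_inP; exists x => //; apply/exists_inP; exists i => //.
    by apply/exists_inP; exists a => //; rewrite ia zi.
  move=> none; have [a aK _] := other_colours (xchoose X0) (xchoose X0).
  exists a => x xZ i iK xi; case/negP: none; apply/exists_inP; exists x => //.
  by apply/exists_inP; exists i.
case: (boolP (two X)) => [|/one[a aX]].
  case/exists_inP=> x1 x1X /exists_inP[x2 x2X /exists_inP[i iK /exists_inP[j jK]]].
  by case/and3P=> ij x1i x2j; apply: (biclique_two_labels (x1 := x1) (x2 := x2)) ij _ _.
case: (boolP (two Y)) => [|/one[b bY]].
  case/exists_inP=> x1 x1X /exists_inP[x2 x2X /exists_inP[i iK /exists_inP[j jK]]].
  case/and3P=> ij x1i x2j; rewrite setUC.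
  apply: (biclique_two_labels (x1 := x1) (x2 := x2)) ij _ _ => //.
  by move=> y x yY xX; rewrite edge_sym XY.
have [p pK /andP[pa _]] := other_colours a a.
have [q qK /andP[qb qp]] := other_colours b p.
apply: (@biclique_two_colours _ _ stX stY (fun=> p) (fun=> q)).
- by move=> x xX; split=> //; apply: contra pa => /(aX _ xX _ pK)->.
- by move=> x xX; split=> //; apply: contra qb => /(bY _ xX _ qK)->.
- by move=> *; rewrite eq_sym.
Qed.

(* The component of a vertex [y] of maximal degree consists of [y], its
   neighbours [A] and the vertices [B] at distance two. It is a union of cliques
   through [y] if [B] is empty, and complete bipartite otherwise. *)
Lemma p4_free_list_colouring (W : {set G}) :
  4 <= w \/ avoids G [:: cycle_rows 5] ->
  W \subset ~: K -> p4_free_on W -> list_colourable W K.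
Proof.
move=> w4; elim: {W}_.+1 {-2}W (ltnSn #|W|) => // n IH W szW WK p4.
case: (set_0Vmem W) => [->|[y0 y0W]].
  by exists id; split=> x; rewrite inE.
pose N x := [set z in W | edge x z].
case: (@arg_maxnP _ y0 (mem W) (fun x => #|N x|) y0W) => y yW' ymax.
have {yW'} yW : y \in W := yW'.
pose A := N y.
pose B := [set z in W | [&& z != y, ~~ edge y z & [exists x in A, edge z x]]].
have AW x : x \in A -> x \in W by rewrite inE => /andP[].
have yA x : x \in A -> edge y x by rewrite inE => /andP[].
have inA x : x \in W -> edge y x -> x \in A by move=> xW yx; rewrite inE xW.
have BP z : z \in B -> [/\ z \in W, z != y, ~~ edge y z & exists2 x, x \in A & edge z x].
  by rewrite inE => /and4P[zW zy yz /exists_inP].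
have inB z x : z \in W -> z != y -> ~~ edge y z -> x \in A -> edge z x -> z \in B.
  by move=> zW zy yz xA zx; rewrite inE zW zy yz; apply/exists_inP; exists x.
(* As x sees y and u but has at most the degree of y, it misses some other z in A; then z y x u
   forces the edge uz. *)
have split_nb u x : u \in B -> x \in A -> edge u x ->
    exists z, [/\ z \in A, z != x, ~~ edge x z & edge u z].
  move=> uB xA ux; have [uW uy yu _] := BP u uB.
  have [z zA /andP[zx xz]] : exists2 z, z \in A & (z != x) && ~~ edge x z.
    apply/exists_inP; apply: contraT; rewrite negb_exists_in => /forall_inP all.
    have le : #|N x| <= #|N y| := ymax x (AW x xA).
    suff : #|y |: (u |: (A :\ x))| <= #|N x|.
      rewrite !cardsU1 !inE negb_or (eq_sym y u) uy edge_irr (negbTE yu) /= !andbF /=.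
      by have := cardsD1 x A; rewrite xA /A; lia.
    apply/subset_leq_card/subsetP => z; case/setU1P=> [->|/setU1P[->|]].
    - by rewrite inE yW edge_sym yA.
    - by rewrite inE uW edge_sym.
    case/setD1P=> zx zA; rewrite inE AW //=.
    by have := all z zA; rewrite zx negbK.
  exists z; split=> //; rewrite edge_sym.
  apply: (p4 z y x u) => //; rewrite ?AW ?yA //; try by rewrite edge_sym.
  by rewrite edge_sym yA.
(* If u misses x, its neighbours x1 and z in A both see x, as u v y x is not an induced P_4 for v =
   x1, z; then y, x, x1, z form a diamond. *)
have complete u x : u \in B -> x \in A -> edge u x.
  move=> uB xA; have [uW uy yu [x1 x1A ux1]] := BP u uB.
  apply/negPn/negP => nux; have [z [zA zx1 x1z uz]] := split_nb u x1 uB x1A ux1.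
  have step v : v \in A -> edge u v -> edge x v.
    move=> vA uv; apply/negPn/negP => nxv; case/negP: nux.
    apply: (p4 u v y x) => //; rewrite ?AW ?yA //; first by rewrite edge_sym yA.
      by rewrite edge_sym.
    by rewrite edge_sym.
  case/negP: x1z.
  apply: (avoids_diamond dia (a := y) (b := x)); rewrite ?yA ?step //.
  by rewrite eq_sym.
have stA : B != set0 -> {in A &, forall a b, ~~ edge a b}.
  case/set0Pn=> u uB a b aA bA; apply/negP => ab.
  have [uW uy yu _] := BP u uB; case/negP: yu.
  apply: (avoids_diamond dia (a := a) (b := b)) => //; last by rewrite eq_sym.
  - by rewrite edge_sym yA.
  - by rewrite edge_sym yA.
  - by rewrite edge_sym complete.
  - by rewrite edge_sym complete.
have stB : {in B &, forall a b, ~~ edge a b}.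
  move=> a b aB bB; apply/negP => ab.
  have [_ _ _ [x xA ax]] := BP a aB.
  have [z [zA zx xz az]] := split_nb a x aB xA ax; case/negP: xz.
  apply: (avoids_diamond dia (a := a) (b := b)) => //; last by rewrite eq_sym.
    exact: complete.
  exact: complete.
pose C := (y |: B) :|: A.
have CW : C \subset W.
  by apply/subsetP=> x; rewrite !inE => /orP[/orP[/eqP->|/andP[]]|/andP[]].
have AK : A \subset ~: K by apply: subset_trans WK; apply/subsetP=> x /AW.
have yK : y \notin K by have := subsetP WK y yW; rewrite inE.
have listC : list_colourable C K.
  have [B0|Bn0] := eqVneq B set0.
    by rewrite /C B0 setU0; apply: windmill_list_colouring.
  apply: biclique_list_colouring => //.
  - by apply/subsetP=> x; rewrite !inE => /orP[/eqP->//|/andP[/(subsetP WK)]]; rewrite inE.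
  - move=> a b /setU1P[->|aB] /setU1P[->|bB]; rewrite ?edge_irr //.
    + by have [] := BP b bB.
    + by rewrite edge_sym; have [] := BP a aB.
    + exact: stB.
  - exact: stA.
  - by move=> a b /setU1P[->|aB] bA; [apply: yA | apply: complete].
  - by exists y; rewrite !inE eqxx.
  - by have [u uB] := set0Pn _ Bn0; have [_ _ _ [x xA _]] := BP u uB; exists x.
have -> : W = C :|: (W :\: C).
  by apply/setP=> x; rewrite in_setU in_setD; case: (boolP (x \in C)) => [/(subsetP CW)->|].
apply: list_colourableU => //; last first.
  apply: IH.
  - have : #|W :\: C| < #|W|; last by lia.
    apply/proper_card/properP; split; first exact: subsetDl.
    by exists y => //; rewrite !inE eqxx.
  - by apply: subset_trans WK; apply: subsetDl.
  - by apply: p4_free_onS p4; apply: subsetDl.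
(* No edge leaves C: from B it would end an induced P_4 y x a z, and from y or A its end would lie
   in A or B. *)
move=> a z aC /setDP[zW zC]; apply/negP => az.
have [zy zB zA] : [/\ z != y, z \notin B & z \notin A].
  by move: zC; rewrite /C !in_setU in_set1 !negb_or => /andP[/andP[]].
have nyz : ~~ edge y z by apply: contra zA; apply: inA.
case/setUP: aC => [/setU1P[ea|aB]|aA].
- by rewrite -ea az in nyz.
- have [aW ay ya [x xA ax]] := BP a aB.
  have nxz : ~~ edge x z.
    by apply: contra zB => xz; apply: (inB z x) => //; rewrite edge_sym.
  case/negP: nyz; apply: (p4 y x a z) => //; rewrite ?AW ?yA //; first by rewrite edge_sym.
- by case/negP: zB; apply: (inB z a) => //; rewrite edge_sym.
Qed.
End ListColouring.

(** * Patterns of a clique and a path *)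

(** Labels count the vertices of K from 1, and 0 stands for no neighbour; [o] is the new order of
    K. *)
Definition relabel (o : seq nat) (l : nat) : nat :=
  if l is l'.+1 then (index l' o).+1 else 0.

(* Up to a permutation of K_w and a reversal of the path, every pattern avoiding
   [F] is in [C]. *)
Definition covers (F : seq (seq bitseq)) (w : nat)
    (C : seq (nat * nat * nat * nat)) : bool :=
  let R := rootings F [::] in
  let P := selections w (iota 0 w) in
  let I := iota 0 w.+1 in
  all (fun a => all (fun b => all (fun c => all (fun d =>
    if has (fun o => ((relabel o a, relabel o b, relabel o c, relabel o d) \in C)
      || ((relabel o d, relabel o c, relabel o b, relabel o a) \in C)) P
    then true else bad R [::] (pat w (a, b, c, d))) I) I) I) I.

Definition forbidden3 := [:: diamond_rows; p2p4_rows; cycle_rows 5; complete_rows 4].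
Definition forbidden4 := [:: diamond_rows; p2p4_rows; complete_rows 5].
Definition forbidden4_c5 := [:: diamond_rows; p2p4_rows; cycle_rows 5; complete_rows 5].
Definition forbidden5 := [:: diamond_rows; p2p4_rows; complete_rows 6].
(** These are eliminated first; the patterns of [patterns3_ext] are then coloured with these
    forbidden as well. *)
Definition patterns3 := [:: (0,1,2,1); (1,0,1,2); (1,2,1,2); (1,2,2,3)].
Definition patterns3_ext := [:: (0,0,1,2); (0,1,1,2); (0,1,2,0); (1,0,0,2); (1,1,2,2)].

Lemma complete_rowsS n : complete_rows n.+1 = nseq n true :: complete_rows n.
Proof. by rewrite /complete_rows -{1}addn1 iotaD rev_cat map_cat. Qed.

Lemma tri_clique (G : sgraph) (s : seq G) :
  uniq s -> {in s &, forall x y, x != y -> edge x y} ->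
  tri s = complete_rows (size s).
Proof.
elim: s => //= x s IH /andP[xs us] cl; rewrite complete_rowsS IH //; last first.
  by move=> y z ys zs; apply: cl; rewrite inE ?ys ?zs orbT.
congr (_ :: _); rewrite /bits; apply: (@eq_from_nth _ false).
  by rewrite size_map size_nseq.
move=> i; rewrite size_map => hi; rewrite nth_nseq hi (nth_map x) //.
apply: cl; rewrite ?inE ?eqxx ?mem_nth ?orbT //.
by apply: contraNneq xs => ->; rewrite mem_nth.
Qed.

Lemma selectionsP k s o : o \in selections k s ->
  [/\ size o = k, uniq o & {subset o <= s}].
Proof.
elim: k o => [|k IH] o /=; first by rewrite inE => /eqP->.
case/flatten_mapP=> t /IH[st ut sub] /mapP[i]; rewrite mem_filter => /andP[it is_] ->.
split=> /=; rewrite ?st ?it //.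
by move=> j; rewrite inE => /predU1P[->|/sub].
Qed.

Definition label (G : sgraph) (s : seq G) (x : G) : nat :=
  if has (edge x) s then (find (edge x) s).+1 else 0.

Definition induced_p4 (G : sgraph) (a b c d : G) : Prop :=
  [/\ edge a b, edge b c & edge c d] /\ [/\ ~~ edge a c, ~~ edge a d & ~~ edge b d].

Section Coverage.
Variables (G : sgraph) (w : nat) (K : {set G}).
Hypotheses (clK : clique K) (cK : #|K| = w)
  (nbK : forall x i j, x \notin K -> i \in K -> j \in K ->
     edge x i -> edge x j -> i = j).

(** Since a vertex outside K has at most one neighbour in K, the four labels determine the graph
    induced on K and the path. *)
Lemma tri_pat (a b c d : G) o :
  a \notin K -> b \notin K -> c \notin K -> d \notin K -> induced_p4 a b c d ->
  size o = w -> uniq o -> {subset o <= iota 0 w} ->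
  let Ks := [seq nth a (enum K) i | i <- o] in
  let l x := relabel o (label (enum K) x) in
  [/\ Ks =i K, uniq [:: a, b, c, d & Ks]
    & tri [:: a, b, c, d & Ks] = pat w (l a, l b, l c, l d)].
Proof.
move=> aK bK cK' dK [[ab bc cd] [ac ad bd]] so uo subo Ks l.
have sE : size (enum K) = w by rewrite -cardE.
have ltw i : i \in o -> i < w by move/subo; rewrite mem_iota.
have oE : o =i iota 0 w.
  by have [] := uniq_min_size uo subo; rewrite ?so ?size_iota.
have uKs : uniq Ks.
  apply: uniq_nths => //; first exact: enum_uniq.
  by apply/allP=> i /ltw; rewrite sE.
have KsE : Ks =i K.
  move=> x; rewrite -mem_enum; apply/mapP/idP => [[i /ltw hi ->]|xK].
    by rewrite mem_nth ?sE.
  exists (index x (enum K)); last by rewrite nth_index.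
  by rewrite oE mem_iota /= add0n -sE index_mem.
have bitsE x : x \notin K -> bits Ks x = [seq l x == i | i <- iota 1 w].
  move=> xK; apply: (@eq_from_nth _ false).
    by rewrite !size_map size_iota so.
  move=> i; rewrite !size_map so => hi.
  rewrite (nth_map a) ?size_map ?so // (nth_map 0) ?so //.
  rewrite (nth_map 0) ?size_iota // nth_iota // add1n.
  have oi : nth 0 o i < w by apply: ltw; rewrite mem_nth ?so.
  rewrite /l /label; case: (boolP (has _ _)) => [h|/hasPn h] /=; last first.
    by apply/negbTE/h; rewrite mem_nth ?sE.
  have hf := nth_find a h; have lf := h; rewrite has_find sE in lf.
  rewrite eqSS; apply/idP/eqP => [e|<-]; last by rewrite nth_index // oE mem_iota.
  have /eqP : nth a (enum K) (find (edge x) (enum K)) = nth a (enum K) (nth 0 o i).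
    by apply: (nbK xK) => //; rewrite -mem_enum mem_nth ?sE.
  by rewrite nth_uniq ?enum_uniq ?sE // => /eqP->; rewrite index_uniq ?so.
have nKs x : x \notin K -> x \notin Ks by rewrite KsE.
split=> //.
  rewrite !cons_uniq uKs (nKs d) // andbT !inE !negb_or !nKs // !andbT.
  by apply/and3P; split; distinct_vertices.
rewrite /= -!/(bits _ _) !bitsE // tri_clique //; last first.
  by move=> x y; rewrite !KsE; apply: (cliqueP _ clK).
by rewrite size_map so ab bc cd (negbTE ac) (negbTE ad) (negbTE bd).
Qed.

Lemma covers_sound F C (a b c d : G) :
  covers F w C -> avoids G F ->
  a \notin K -> b \notin K -> c \notin K -> d \notin K -> induced_p4 a b c d ->
  exists Ks p q r t l, [/\ l \in C, Ks =i K, uniq [:: p, q, r, t & Ks],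
    tri [:: p, q, r, t & Ks] = pat w l
    & [:: p; q; r; t] = [:: a; b; c; d] \/ [:: p; q; r; t] = [:: d; c; b; a]].
Proof.
move=> cov av aK bK cK' dK p4.
have p4' : induced_p4 d c b a.
  have [[ab bc cd] [ac ad bd]] := p4.
  by split; split; rewrite edge_sym.
have lw x : label (enum K) x \in iota 0 w.+1.
  rewrite mem_iota /label; case: ifP => //; rewrite has_find -cardE cK.
  by move=> h; rewrite /= add0n ltnS.
have := allP (allP (allP (allP cov _ (lw a)) _ (lw b)) _ (lw c)) _ (lw d).
case: hasP => [[o /selectionsP[so uo subo] hC] _|_].
  have [] := tri_pat aK bK cK' dK p4 so uo subo.
  have [] := tri_pat dK cK' bK aK p4' so uo subo.
  case/orP: hC => hC *; [exists [seq nth a (enum K) i | i <- o], a, b, c, d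
    | exists [seq nth d (enum K) i | i <- o], d, c, b, a].
    by exists (relabel o (label (enum K) a), relabel o (label (enum K) b),
      relabel o (label (enum K) c), relabel o (label (enum K) d)); split=> //; left.
  by exists (relabel o (label (enum K) d), relabel o (label (enum K) c),
    relabel o (label (enum K) b), relabel o (label (enum K) a)); split=> //; right.
have [|||_ us] := tri_pat aK bK cK' dK p4 (o := iota 0 w); rewrite ?size_iota ?iota_uniq //.
have relE x : relabel (iota 0 w) (label (enum K) x) = label (enum K) x.
  have := lw x; rewrite mem_iota /=; case: (label _ x) => //= l hl.
  by rewrite -{1}(add0n l) -(@nth_iota 0 0 w l) // index_uniq ?size_iota ?iota_uniq.
rewrite !relE => <-; rewrite (@bad_sound G F [::] a) //.
Qed.
End Coverage.

(** * Colourings with omega given *)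

Lemma avoids_sub (G : sgraph) F F' :
  {subset F' <= F} -> avoids G F -> avoids G F'.
Proof. by move=> sub av s us; apply: contra (av s us); apply: sub. Qed.

Lemma avoids_cons (G : sgraph) p F :
  avoids G [:: p] -> avoids G F -> avoids G (p :: F).
Proof.
move=> avp avF s us; rewrite inE negb_or avF // andbT.
by have := avp s us; rewrite inE.
Qed.

Lemma copy_or_avoids (G : sgraph) p :
  (exists2 s : seq G, uniq s & tri s = p) \/ avoids G [:: p].
Proof.
case: (boolP [exists t : (size p).-tuple G, uniq t && (tri t == p)]).
  by case/existsP=> t /andP[ut /eqP tp]; left; exists t.
move=> none; right => s us; rewrite inE; apply: contra none => /eqP sp.
have sz : size s == size p by rewrite -sp size_tri.
by apply/existsP; exists (Tuple sz); rewrite /= us sp eqxx.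
Qed.

Lemma omega_avoids (G : sgraph) w :
  (forall S : {set G}, clique S -> #|S| <= w) -> avoids G [:: complete_rows w.+1].
Proof.
move=> om s us; rewrite inE; apply/eqP => E.
have sz : size s = w.+1 by rewrite -size_tri E !size_map size_rev size_iota.
have cl : clique [set x in s].
  elim: s w.+1 {om us sz} E => [|x s IH] n.
    by move=> _; apply/cliqueP => x y; rewrite inE.
  case: n => [//|n]; rewrite complete_rowsS /= => -[E1 E2].
  rewrite set_cons; apply: cliqueU1; last exact: IH E2.
  move=> y; rewrite inE => ys; have : edge x y \in bits s x by apply: map_f.
  by rewrite E1 => /nseqP[->].
have := om _ cl; rewrite cardsE (card_uniqP us) sz ltnn.
by [].
Qed.

Lemma p4_free_or_p4 (G : sgraph) (W : {set G}) :
  p4_free_on W \/ exists a b c d, [/\ a \in W, b \in W, c \in W & d \in W] /\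
    induced_p4 a b c d.
Proof.
case: (boolP [exists a in W, exists b in W, exists c in W, exists d in W,
  [&& edge a b, edge b c, edge c d, ~~ edge a c, ~~ edge a d & ~~ edge b d]]).
  case/exists_inP=> a aW /exists_inP[b bW /exists_inP[c cW /exists_inP[d dW]]].
  by case/and5P=> ab bc cd ac /andP[ad bd]; right; exists a, b, c, d.
move=> none; left => a b c d aW bW cW dW ab bc cd ac bd.
apply: contraT => ad; case/negP: none; apply/exists_inP; exists a => //.
apply/exists_inP; exists b => //; apply/exists_inP; exists c => //.
by apply/exists_inP; exists d => //; rewrite ab bc cd ac bd ad.
Qed.

Lemma table_colourable0 (G : sgraph) F k m (s : seq G) :
  avoids G F -> uniq s -> tri s = m -> table F k m [::] [::] ->
  colourable_on [set: G] k.
Proof.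
by move=> av us <-; apply: (table_colourable (psi := fun=> false)) => // x y _ _ _ _.
Qed.

Lemma table_colourable_drop (G : sgraph) F k m t (s : seq G) :
  avoids G F -> uniq s -> tri s = m -> (forall x, x \notin s -> bits s x <> t) ->
  table F k m [::] [:: (t, false)] -> colourable_on [set: G] k.
Proof.
move=> av us <- nt; apply: (table_colourable (psi := fun=> false)) => //.
by move=> x xs; rewrite inE; apply/eqP => -[]; apply: nt.
Qed.

(** Every vertex of K is its own colour. *)
Lemma list_colourable_extend (G : sgraph) (K : {set G}) :
  clique K -> list_colourable (~: K) K -> colourable_on [set: G] #|K|.
Proof.
move=> clK [c [cK cE]].
pose f x := if x \in K then x else c x.
have fK x : f x \in K.
  by rewrite /f; case: ifP => // xK; case: (cK x); rewrite ?inE ?xK.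
exists (fun x => index (f x) (enum K)); split=> [x _|x y _ _ xy].
  by rewrite cardE index_mem mem_enum.
move/(congr1 (nth x (enum K))); rewrite !nth_index ?mem_enum //.
have nf u v : u \notin K -> edge u v -> c u <> v.
  by move=> uK uv e; case: (cK u); rewrite ?inE // e uv.
rewrite /f; case: ifP => xK; case: ifP => yK.
- by move=> e; rewrite e edge_irr in xy.
- by apply/nesym/nf; rewrite ?yK // edge_sym.
- by apply: nf; rewrite ?xK.
- by apply: cE; rewrite ?inE ?xK ?yK.
Qed.

(** * Patterns treated by computation *)

Definition forbidden3_ext := forbidden3 ++ [seq pat 3 l | l <- patterns3].
(* Adjacencies to a path a, b, c, d and a clique: to b only, and so on. *)
Definition only_b := [:: false; true; false; false; false; false; false].
Definition only_bc := [:: false; true; true; false; false; false; false; false].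
Definition only_c := [:: false; false; true; false; false; false; false].

Definition patterns4 := [:: (1,0,2,3); (1,1,2,3); (1,2,1,3); (1,2,2,3); (1,2,3,4)].
Definition patterns4_ext := [:: (0,1,2,3); (1,2,3,1)].

Lemma covers_patterns3 :
  covers forbidden3 3 (patterns3 ++ patterns3_ext ++ [:: (0,1,2,2); (1,1,2,1)]).
Proof. by vm_compute. Qed.

Lemma covers_patterns4 : covers forbidden4 4 (patterns4 ++ patterns4_ext).
Proof. by vm_compute. Qed.

Lemma covers_patterns4_c5 : covers forbidden4_c5 4 [:: (1,2,2,3)].
Proof. by vm_compute. Qed.

Lemma covers_patterns5 : covers [:: diamond_rows; p2p4_rows] 5 [:: (1,2,3,4)].
Proof. by vm_compute. Qed.

Lemma table_patterns3 : all (fun l => table forbidden3 3 (pat 3 l) [::] [::]) patterns3.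
Proof. by vm_compute. Qed.

Lemma table_patterns3_ext :
  all (fun l => table forbidden3_ext 3 (pat 3 l) [::] [::]) patterns3_ext.
Proof. by vm_compute. Qed.

Lemma table_0122_edge :
  table forbidden3 3 [:: true :: only_b, only_b & pat 3 (0, 1, 2, 2)]
  [:: [:: false, false & only_b]] [::].
Proof. by vm_compute. Qed.

Lemma table_0122_no_edge :
  table forbidden3_ext 3 (pat 3 (0, 1, 2, 2)) [:: only_b] [:: (only_b, true)].
Proof. by vm_compute. Qed.

Lemma table_1121 :
  table forbidden3_ext 3 (pat 3 (1, 1, 2, 1)) [::] [:: (only_c, false)].
Proof. by vm_compute. Qed.

Lemma table_patterns4 : all (fun l => table forbidden4 6 (pat 4 l) [::] [::]) patterns4.
Proof. by vm_compute. Qed.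

Lemma table_patterns4_ext :
  all (fun l => table forbidden4 6 (pat 4 l) [::] [:: (only_bc, false)])
    patterns4_ext.
Proof. by vm_compute. Qed.

Lemma table_patterns4_only_bc :
  all (fun l => table forbidden4 6 (only_bc :: pat 4 l) [::] [::])
    patterns4_ext.
Proof. by vm_compute. Qed.

Lemma table4_1223 : table forbidden4_c5 4 (pat 4 (1,2,2,3)) [::] [::].
Proof. by vm_compute. Qed.

Lemma table5_1234 : table forbidden5 6 (pat 5 (1,2,3,4)) [::] [::].
Proof. by vm_compute. Qed.

Lemma bad_1234 : bad (rootings [:: cycle_rows 5] [::]) [::] (pat 5 (1,2,3,4)).
Proof. by vm_compute. Qed.

(* If two vertices whose only neighbour in the base graph is b are adjacent, add
   them to the base graph: then the vertices of this class induce a matching, and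
   they get two colours. *)
Lemma pattern_0122 (G : sgraph) (s : seq G) :
  avoids G forbidden3_ext -> uniq s -> tri s = pat 3 (0, 1, 2, 2) ->
  colourable_on [set: G] 3.
Proof.
move=> av us ts.
have avF : avoids G forbidden3 by apply: avoids_sub av => p; rewrite mem_cat => ->.
case: (boolP [exists z, exists z', [&& z \notin s, z' \notin s, bits s z == only_b,
    bits s z' == only_b & edge z' z]]); last first.
  move=> none; apply: (table_colourable (F := forbidden3_ext) (s := s) (sp := [:: only_b])
    (dropped := [:: (only_b, true)]) (psi := fun=> false)) => //.
  - by move=> x _; rewrite inE; apply/eqP => -[].
  - move=> x y xs ys xy e; rewrite inE => zx _; case/negP: none.
    by apply/existsP; exists y; apply/existsP; exists x; rewrite xs ys xy -e zx.
  - by rewrite ts table_0122_no_edge.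
case/existsP=> z /existsP[z' /and5P[zs z's /eqP bz /eqP bz' z'z]].
pose s' := [:: z', z & s].
have us' : uniq s'.
  rewrite /= inE negb_or z's zs us !andbT.
  by apply: contraTneq z'z => ->; rewrite edge_irr.
have ts' : tri s' = [:: true :: only_b, only_b & pat 3 (0, 1, 2, 2)].
  by rewrite /s' /= ts -/(bits s z') bz bz' z'z.
pose t := [:: false, false & only_b].
have size_s : size s = 7 by rewrite -size_tri ts.
case: s size_s => [//|a [//|b s]] size_s in us ts zs z's bz bz' s' us' ts' *.
have cb x : bits s' x = t -> edge x b by rewrite /s' /t /bits /= => -[].
have av4 : avoids G [:: complete_rows 4].
  by apply: avoids_sub avF => p; rewrite !inE => ->; rewrite !orbT.
have dia : avoids G [:: diamond_rows].
  by apply: avoids_sub avF => p; rewrite !inE => ->.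
(* All vertices of the class see b, so b, x, y, u would form a diamond or a K_4. *)
have matching x y u : bits s' x = t -> bits s' y = t -> bits s' u = t ->
    edge x y -> edge x u -> y = u.
  move=> /cb xb /cb yb /cb ub xy xu; apply/eqP/negPn/negP => yu.
  have eyu : edge y u.
    by apply: (avoids_diamond dia (a := b) (b := x)); rewrite // edge_sym.
  have uu : uniq [:: u; y; x; b].
    have ne (v v' : G) : edge v v' -> v' != v.
      by apply: contraTneq => ->; rewrite edge_irr.
    by rewrite /= !inE !negb_or !andbT !(ne _ _) // edge_sym.
  by have := av4 _ uu; rewrite /= /bits /=; rewrite_edges.
(* In each edge of the matching, the end of larger rank goes to the second half. *)
pose psi x := (bits s' x == t) && [exists y, [&& bits s' y == t, edge x y &
  enum_rank y < enum_rank x]].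
have asym x y : bits s' x = t -> bits s' y = t -> edge x y ->
    enum_rank x < enum_rank y -> psi x <> psi y.
  move=> xt yt xy lt; have -> : psi y.
    by rewrite /psi yt eqxx; apply/existsP; exists x; rewrite xt eqxx edge_sym xy.
  case/andP=> _ /existsP[u /and3P[/eqP ut xu ux]].
  by have := ltn_trans ux lt; rewrite (matching x y u) ?ltnn.
apply: (table_colourable (F := forbidden3) (s := s') (sp := [:: t]) (dropped := [::])
  (psi := psi)) => //.
- by move=> x _; rewrite inE => /andP[].
- move=> x y _ _ xy e; rewrite inE => /eqP xt; have yt := xt; rewrite e in yt.
  case: (ltngtP (enum_rank x) (enum_rank y)) => h.
  + exact: asym.
  + by apply/nesym/asym; rewrite // edge_sym.
  + by move/val_inj/enum_rank_inj: h => h; rewrite h edge_irr in xy.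
- by rewrite ts' table_0122_edge.
Qed.

(* If the only neighbour of z in the base graph is c, then the path z, c, k_2, k_3
   and the triangle b, k_1, a form the pattern (0,1,2,2). *)
Lemma pattern_1121 (G : sgraph) (s : seq G) :
  avoids G forbidden3_ext -> uniq s -> tri s = pat 3 (1, 1, 2, 1) ->
  colourable_on [set: G] 3.
Proof.
move=> av us ts.
case: (boolP [exists z, (z \notin s) && (bits s z == only_c)]) => [|none]; last first.
  apply: (table_colourable_drop av us ts _ table_1121).
  by move=> x xs e; case/negP: none; apply/existsP; exists x; rewrite xs e eqxx.
case/existsP=> z /andP[zs /eqP bz].
have sz : size s = 7 by rewrite -size_tri ts.
(* Positions in z, a, b, c, d, k_1, k_2, k_3. *)
pose o := [:: 0; 3; 6; 7; 2; 5; 1].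
have lto : all (fun i => i < size (z :: s)) o by rewrite /= sz.
apply: (@pattern_0122 G [seq nth z (z :: s) i | i <- o]) => //.
  by apply: uniq_nths => //=; rewrite zs.
by rewrite tri_submatrix //= bz ts; vm_compute.
Qed.

(** * Colourings relative to a maximum clique *)

Section Omega.
Variables (G : sgraph) (K : {set G}).
Hypotheses (dia : avoids G [:: diamond_rows]) (p2p4 : avoids G [:: p2p4_rows])
  (clK : clique K) (K3 : 3 <= #|K|)
  (omK : forall S : {set G}, clique S -> #|S| <= #|K|).

Let nbK x i j : x \notin K -> i \in K -> j \in K -> edge x i -> edge x j -> i = j.
Proof. exact: (neighbour_in_clique dia clK erefl omK). Qed.

Lemma p4_free_compl_colourable :
  4 <= #|K| \/ avoids G [:: cycle_rows 5] -> p4_free_on (~: K) ->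
  colourable_on [set: G] #|K|.
Proof.
move=> K4 p4; apply: list_colourable_extend => //.
exact: (p4_free_list_colouring dia clK erefl K3 omK).
Qed.

Lemma omega3_c5_free_colourable :
  #|K| = 3 -> avoids G [:: cycle_rows 5] -> colourable_on [set: G] 3.
Proof.
move=> cK c5; have avF : avoids G forbidden3.
  by do 3!apply: avoids_cons => //; apply: omega_avoids; rewrite -cK.
have try F l : avoids G F -> table F 3 (pat 3 l) [::] [::] ->
    colourable_on [set: G] 3 \/ avoids G [:: pat 3 l].
  move=> av tab; have [[s us ts]|] := copy_or_avoids G (pat 3 l); last by right.
  by left; apply: table_colourable0 av us ts tab.
have all_of F C : avoids G F -> all (fun l => table F 3 (pat 3 l) [::] [::]) C ->
    colourable_on [set: G] 3 \/ avoids G [seq pat 3 l | l <- C].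
  move=> av; elim: C => [|l C IH] /=; first by right => s _; rewrite in_nil.
  case/andP=> /(try _ _ av)[c _|avl /IH[c|avC]]; [by left | by left |].
  by right; apply: avoids_cons.
have [//|av1] := all_of _ _ avF table_patterns3.
have avX : avoids G forbidden3_ext.
  by move=> s us; rewrite mem_cat negb_or (avF s us) (av1 s us).
have [//|av2] := all_of _ _ avX table_patterns3_ext.
have [p4|[a [b [c [d [[aK bK cK' dK] p4]]]]]] := p4_free_or_p4 (~: K).
  by rewrite -cK; apply: p4_free_compl_colourable => //; right.
rewrite !inE in aK bK cK' dK.
have [Ks [p [q [r [t [l [lC _ us ts _]]]]]]] :=
  covers_sound clK cK nbK covers_patterns3 avF aK bK cK' dK p4.
move: lC; rewrite !mem_cat => /or3P[h|h|].
- by have := av1 _ us; rewrite ts map_f.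
- by have := av2 _ us; rewrite ts map_f.
rewrite !inE => /orP[] /eqP e; rewrite e in ts.
- exact: pattern_0122 avX us ts.
- exact: pattern_1121 avX us ts.
Qed.

Lemma p4_free_or_pattern w F C :
  #|K| = w -> covers F w C -> avoids G F ->
  p4_free_on (~: K) \/
  exists s l, [/\ l \in C, uniq s & tri (s : seq G) = pat w l].
Proof.
move=> cK cov av; have [p4|[a [b [c [d [[aK bK cK' dK] p4]]]]]] := p4_free_or_p4 (~: K).
  by left.
rewrite !inE in aK bK cK' dK.
have [Ks [p [q [r [t [l [lC _ us ts _]]]]]]] :=
  covers_sound clK cK nbK cov av aK bK cK' dK p4.
by right; exists [:: p, q, r, t & Ks], l.
Qed.

Lemma omega4_c5_free_colourable :
  #|K| = 4 -> avoids G [:: cycle_rows 5] -> colourable_on [set: G] 4.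
Proof.
move=> cK c5; have avF : avoids G forbidden4_c5.
  by do 3!apply: avoids_cons => //; apply: omega_avoids; rewrite -cK.
have [p4|[s [l [lC us ts]]]] := p4_free_or_pattern cK covers_patterns4_c5 avF.
  by rewrite -cK; apply: p4_free_compl_colourable => //; left; rewrite cK.
rewrite inE in lC; rewrite (eqP lC) in ts.
exact: table_colourable0 avF us ts table4_1223.
Qed.

Lemma omega4_colourable : #|K| = 4 -> colourable_on [set: G] 6.
Proof.
move=> cK; have avF : avoids G forbidden4.
  by do 2!apply: avoids_cons => //; apply: omega_avoids; rewrite -cK.
have [p4|[s [l [lC us ts]]]] := p4_free_or_pattern cK covers_patterns4 avF.
  have [|c [ck ce]] := p4_free_compl_colourable _ p4; first by left; rewrite cK.
  by exists c; split=> // x xW; apply: leq_trans (ck x xW) _; rewrite cK.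
move: lC; rewrite mem_cat => /orP[lC|lC].
  exact: table_colourable0 avF us ts (allP table_patterns4 _ lC).
(* A vertex seeing exactly b and c joins the base graph; if there is none, its class is dropped. *)
case: (boolP [exists z, (z \notin s) && (bits s z == only_bc)]) => [|none].
  case/existsP=> z /andP[zs /eqP bz].
  apply: (@table_colourable0 G forbidden4 6 (only_bc :: pat 4 l) (z :: s)) => //=.
  - by rewrite zs.
  - by rewrite bz ts.
  - exact: (allP table_patterns4_only_bc _ lC).
apply: (table_colourable_drop avF us ts (t := only_bc)); last first.
  exact: (allP table_patterns4_ext _ lC).
by move=> x xs e; case/negP: none; apply/existsP; exists x; rewrite xs e eqxx.
Qed.

Lemma omega5_colourable : #|K| = 5 -> colourable_on [set: G] 6.
Proof.
move=> cK; have av : avoids G [:: diamond_rows; p2p4_rows] by apply: avoids_cons.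
have [p4|[s [l [lC us ts]]]] := p4_free_or_pattern cK covers_patterns5 av.
  have [|c [ck ce]] := p4_free_compl_colourable _ p4; first by left; rewrite cK.
  by exists c; split=> // x xW; apply: leq_trans (ck x xW) _; rewrite cK.
have avF : avoids G forbidden5.
  by do 2!apply: avoids_cons => //; apply: omega_avoids; rewrite -cK.
rewrite inE in lC; rewrite (eqP lC) in ts.
exact: table_colourable0 avF us ts table5_1234.
Qed.

Lemma p4_free_away_from_edge i j (W : {set G}) :
  edge i j -> {in W, forall x, ~~ edge i x /\ ~~ edge j x} -> p4_free_on W.
Proof.
move=> ij nW a b c d aW bW cW dW ab bc cd ac bd; apply: contraT => ad; exfalso.
have [ia ja] := nW a aW; have [ib jb] := nW b bW.
have [ic jc] := nW c cW; have [id jd] := nW d dW.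
exact: (avoids_p2p4 p2p4 ij ab bc cd).
Qed.

(** The vertices of a P_4 see at most four vertices of K; two others form with it a P_2 + P_4. *)
Lemma omega_ge6_p4_free : 6 <= #|K| -> p4_free_on (~: K).
Proof.
move=> K6; have [//|[a [b [c [d [[aK bK cK' dK] p4]]]]]] := p4_free_or_p4 (~: K).
have N1 x : x \in ~: K -> #|[set k in K | edge x k]| <= 1.
  rewrite inE => xK; apply/card_le1_eqP => i j.
  by rewrite !inE => /andP[iK xi] /andP[jK xj]; exact: (nbK xK jK iK xj xi).
pose U := [set k in K | edge a k] :|: [set k in K | edge b k] :|:
  [set k in K | edge c k] :|: [set k in K | edge d k].
have cU : #|U| <= 4.
  have := N1 a aK; have := N1 b bK; have := N1 c cK'; have := N1 d dK.
  by rewrite /U !cardsU; lia.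
have /card_gt1P[i [j [iU jU ij]]] : 1 < #|K :\: U|.
  by rewrite cardsD; have := subset_leq_card (subsetIr K U); lia.
have nU k : k \in K :\: U -> k \in K /\
    forall x, x \in [:: a; b; c; d] -> ~~ edge k x.
  rewrite !inE !negb_or => /andP[/andP[/andP[/andP[ka kb] kc] kd] kK].
  split=> // x; rewrite !inE edge_sym; move: ka kb kc kd; rewrite kK /=.
  by move=> ka kb kc kd; case/or4P=> /eqP->.
have [iK ni] := nU i iU; have [jK nj] := nU j jU.
have [[ab bc cd] [ac ad bd]] := p4.
case: (avoids_p2p4 p2p4 (cliqueP _ clK i j iK jK ij) ab bc cd ac ad bd);
  by [apply: ni; rewrite !inE eqxx ?orbT | apply: nj; rewrite !inE eqxx ?orbT].
Qed.

Lemma omega_ge6_colourable : 6 <= #|K| -> colourable_on [set: G] #|K|.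
Proof.
move=> K6; apply: p4_free_compl_colourable (omega_ge6_p4_free K6).
by left; apply: leq_trans K6.
Qed.

(** When |K| = 5 the only pattern is (1,2,3,4), which contains a C_5. *)
Lemma omega_ge5_c5_free_p4_free :
  5 <= #|K| -> avoids G [:: cycle_rows 5] -> p4_free_on (~: K).
Proof.
rewrite leq_eqVlt => /orP[/eqP cK|K6] c5; last exact: omega_ge6_p4_free.
have av : avoids G [:: diamond_rows; p2p4_rows] by apply: avoids_cons.
have [//|[s [l [lC us ts]]]] := p4_free_or_pattern (esym cK) covers_patterns5 av.
rewrite inE in lC; rewrite (eqP lC) in ts.
have [x0 _] : exists x0 : G, x0 \in K by apply/card_gt0P; rewrite -cK.
by have := @bad_sound G _ [::] x0 s [::] c5 us isT isT erefl; rewrite ts bad_1234.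
Qed.

Lemma c5_free_colourable :
  avoids G [:: cycle_rows 5] -> colourable_on [set: G] #|K|.
Proof.
move=> c5; case: (ltngtP #|K| 4) => cK.
- have cK3 : #|K| = 3 by apply/eqP; rewrite eqn_leq K3 -ltnS cK.
  by rewrite cK3; apply: omega3_c5_free_colourable.
- apply: p4_free_compl_colourable; first by right.
  exact: omega_ge5_c5_free_p4_free.
- by rewrite cK; apply: omega4_c5_free_colourable.
Qed.
End Omega.

(** * Six colours for clique number three *)

Section Omega3.
Variables (G : sgraph) (K : {set G}).
Hypotheses (dia : avoids G [:: diamond_rows]) (p2p4 : avoids G [:: p2p4_rows])
  (clK : clique K) (cK : #|K| = 3)
  (omK : forall S : {set G}, clique S -> #|S| <= 3).

(* The vertices without neighbour in K are 3-coloured; the [j]-th colour class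
   and the vertices attached to the [j]-th vertex of K induce a P_4-free graph
   without triangles. *)
Lemma omega3_colourable : colourable_on [set: G] 6.
Proof.
have nbK x i j : x \notin K -> i \in K -> j \in K -> edge x i -> edge x j -> i = j.
  by apply: (neighbour_in_clique dia clK erefl); rewrite cK.
have /card_gt0P[x0 x0K] : 0 < #|K| by rewrite cK.
pose k j := nth x0 (enum K) j.
have sK : size (enum K) = 3 by rewrite -cardE.
have kK j : j < 3 -> k j \in K by move=> lt; rewrite -mem_enum mem_nth ?sK.
have kk i j : i < 3 -> j < 3 -> i != j -> edge (k i) (k j).
  move=> hi hj ij; apply: (cliqueP _ clK); rewrite ?kK //.
  by rewrite nth_uniq ?sK ?enum_uniq.
pose Z := [set x | (x \notin K) && [forall i in K, ~~ edge x i]].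
have ZP x i : x \in Z -> i \in K -> ~~ edge i x.
  by rewrite inE => /andP[_ /forall_inP h] /h; rewrite edge_sym.
have [zeta [z3 zp]] : colourable_on Z 3.
  apply: p4_free_colourable => [|Q _]; last exact: omK.
  apply: (p4_free_away_from_edge p2p4 (kk 0 1 isT isT isT)) => x xZ.
  by split; apply: ZP; rewrite ?kK.
pose W j := [set x | (x \notin K) &&
  (edge x (k j) || (x \in Z) && (zeta x == j))].
have WP j x i : i < 3 -> j < 3 -> i != j -> x \in W j -> ~~ edge (k i) x.
  move=> hi hj ij; rewrite inE => /andP[xK /orP[xj|/andP[xZ _]]]; last by rewrite ZP ?kK.
  apply/negP => xi; have := kk i j hi hj ij.
  by rewrite (nbK x (k i) (k j)) ?kK ?edge_irr // edge_sym.
have cW j : j < 3 -> colourable_on (W j) 2.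
  move=> hj; apply: p4_free_colourable => [|Q QW clQ].
    have [i [i' [hi hi' ii' ij i'j]]] : exists i i',
        [/\ i < 3, i' < 3, i != i', i != j & i' != j].
      clear -hj; by case: j hj => [|[|[|]]] // _; [exists 1, 2|exists 0, 2|exists 0, 1].
    apply: (p4_free_away_from_edge p2p4 (kk i i' hi hi' ii')) => x xW.
    by split; apply: WP xW.
  (* In a triangle at most one vertex is only in the j-th colour class of [zeta], so two see k_j;
     then so does the third, and a K_4 arises. *)
  rewrite leqNgt; apply/negP => /card_gt2P[x [y [z [[xQ yQ zQ] [xy yz zx]]]]].
  have e u v : u \in Q -> v \in Q -> u != v -> edge u v := cliqueP _ clQ u v.
  have att u v : u \in Q -> v \in Q -> u != v -> edge u (k j) || edge v (k j).
    move=> uQ vQ uv; have := subsetP QW u uQ; have := subsetP QW v vQ.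
    rewrite !inE => /andP[_ /orP[->|/andP[vZ /eqP zv]]]; first by rewrite orbT.
    case/andP=> _ /orP[->//|/andP[uZ /eqP zu]].
    by have := zp u v; rewrite !inE => /(_ uZ vZ (e u v uQ vQ uv)); rewrite zv zu.
  have three u v t : u \in Q -> v \in Q -> t \in Q -> u != v -> v != t -> t != u ->
      edge u (k j) -> edge v (k j) -> False.
    move=> uQ vQ tQ uv vt tu uk vk.
    have tk : t != k j.
      by apply: contraTneq (kK j hj) => <-; have := subsetP QW t tQ; rewrite inE => /andP[].
    have etk : edge t (k j).
      apply: (avoids_diamond dia (a := u) (b := v)) => //; apply: e => //.
      by rewrite eq_sym.
    have cl : clique [set k j; u; v; t].
      rewrite -!setUA; apply: cliqueU1; last first.
        by apply: cliqueS clQ; rewrite !subUset !sub1set uQ vQ.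
      by move=> a; rewrite !inE edge_sym => /or3P[]/eqP->.
    have nk a : a \in Q -> k j != a.
      move=> aQ; apply: contraTneq (kK j hj) => ->.
      by have := subsetP QW a aQ; rewrite inE => /andP[].
    have := omK cl; rewrite -!setUA !cardsU1 !inE !negb_or cards1 !nk // uv vt.
    by rewrite (eq_sym u) tu.
  have := att x y xQ yQ xy; have := att y z yQ zQ yz; have := att z x zQ xQ zx.
  case: (boolP (edge x (k j))) => hx; case: (boolP (edge y (k j))) => hy;
    case: (boolP (edge z (k j))) => hz //= _ _ _.
  - exact: (three x y z).
  - exact: (three x y z).
  - by apply: (three z x y).
  - by apply: (three y z x).
have [c0 [lt0 ne0]] := cW 0 isT; have [c1 [lt1 ne1]] := cW 1 isT.
have [c2 [lt2 ne2]] := cW 2 isT.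
(* W j uses the colours 2j and 2j + 1. Outside K, the vertex k_j has neighbours only in W j, so it
   takes the first colour of the next pair, cyclically. *)
pose c x := if x \in W 0 then c0 x else if x \in W 1 then 2 + c1 x else 4 + c2 x.
pose d x := if x \in K then nth 0 [:: 2; 4; 0] (index x (enum K)) else c x.
have idx x : x \in K -> index x (enum K) < 3 /\ x = k (index x (enum K)).
  by move=> xK; rewrite -sK index_mem /k nth_index mem_enum.
have inW x : x \notin K -> x \notin W 0 -> x \notin W 1 -> x \in W 2.
  move=> xK; rewrite !inE xK /= !negb_or => /andP[x0' nz0] /andP[x1 nz1].
  case: (boolP (edge x (k 2))) => //= x2.
  have xZ : [forall i in K, ~~ edge x i].
    apply/forall_inP => i iK; have [hi iE] := idx i iK; rewrite iE.
    by move: (index i (enum K)) hi => [|[|[|]]].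
  have := z3 x; rewrite inE xK xZ => /(_ isT).
  move: nz0 nz1; rewrite xZ /=.
  by case: (zeta x) => [|[|[|]]].
have cross x y : x \in K -> y \notin K -> edge x y -> d x <> d y.
  move=> xK yK xy; rewrite /d xK (negbTE yK); have [hi xE] := idx x xK.
  set i := index x (enum K) in hi xE *.
  have yW : y \in W i by rewrite inE yK -xE edge_sym xy.
  have nW j : j < 3 -> i != j -> y \notin W j.
    move=> hj ij; apply/negP => yj; have := WP j y i hi hj ij yj.
    by rewrite -xE xy.
  case: i hi {xE} yW nW => [|[|[|]]] // _ yW nW /=; rewrite /c.
  - by rewrite yW => e; have := lt0 y yW; rewrite -e.
  - by rewrite (negbTE (nW 0 _ _)) // yW => e; move: e (lt1 y yW); clear; lia.
  - by rewrite (negbTE (nW 0 _ _)) // (negbTE (nW 1 _ _)).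
exists d; split=> [x _|x y _ _ xy].
  rewrite /d; case: ifP => [xK|/negbT xK].
    by have [] := idx x xK; case: (index _ _) => [|[|[|]]].
  rewrite /c; case: ifP => [x0W|/negbT nx0]; first by have := lt0 x x0W; clear; lia.
  case: ifP => [x1W|/negbT nx1]; first by have := lt1 x x1W; clear; lia.
  by have := lt2 x (inW x xK nx0 nx1); clear; lia.
case: (boolP (x \in K)) => xK; case: (boolP (y \in K)) => yK.
- rewrite /d xK yK; have [hx xE] := idx x xK; have [hy yE] := idx y yK.
  have : index x (enum K) != index y (enum K).
    by apply: contraTneq xy => e; rewrite xE yE e edge_irr.
  by case: (index x _) hx => [|[|[|]]] //; case: (index y _) hy => [|[|[|]]].
- exact: cross.
- by apply/nesym/cross; rewrite // edge_sym.
rewrite /d (negbTE xK) (negbTE yK) /c.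
case: (boolP (x \in W 0)) => [x0W|nx0]; case: (boolP (y \in W 0)) => [y0W|ny0].
- exact: ne0.
- by have := lt0 x x0W; case: ifP => _; clear; lia.
- by have := lt0 y y0W; case: ifP => _; clear; lia.
case: (boolP (x \in W 1)) => [x1W|nx1]; case: (boolP (y \in W 1)) => [y1W|ny1].
- by have := ne1 x y x1W y1W xy; clear; lia.
- by have := lt1 x x1W; clear; lia.
- by have := lt1 y y1W; clear; lia.
by have := ne2 x y (inW x xK nx0 nx1) (inW y yK ny0 ny1) xy; clear; lia.
Qed.
End Omega3.

(* A clique contains at most two vertices of a C_7, and they are consecutive; hence
   five consecutive vertices lie outside of it. *)
Definition clique_bits (v : bitseq) : bool :=
  all (fun i => all (fun j => nth false v i && nth false v j ==>
    ((i == j) || adj (square (cycle_rows 7)) i j)) (iota 0 7)) (iota 0 7).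

Definition free_window (v : bitseq) : bool :=
  has (fun i => all (fun j => ~~ nth false v ((i + j) %% 7)) (iota 0 5)) (iota 0 7).

Lemma clique_free_window :
  all (fun v => clique_bits v ==> free_window v) (all_bits 7).
Proof. by vm_compute. Qed.

Lemma window_adj :
  all (fun i => all (fun j => all (fun k => (j < k) ==>
    (adj (square (cycle_rows 7)) ((i + j) %% 7) ((i + k) %% 7) == (k == j.+1)))
    (iota 0 5)) (iota 0 5)) (iota 0 7).
Proof. by vm_compute. Qed.

(** * Excluding C_7 when the clique number is at least four *)

Section CycleSeven.
Variables (G : sgraph) (K : {set G}).
Hypotheses (dia : avoids G [:: diamond_rows]) (p2p4 : avoids G [:: p2p4_rows])
  (c5 : avoids G [:: cycle_rows 5])
  (clK : clique K) (K4 : 4 <= #|K|)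
  (omK : forall S : {set G}, clique S -> #|S| <= #|K|).

Let nbK x i j : x \notin K -> i \in K -> j \in K -> edge x i -> edge x j -> i = j.
Proof. exact: (neighbour_in_clique dia clK erefl omK). Qed.

(** For |K| = 4 the only pattern is (1,2,2,3), where the two middle vertices share their neighbour
    in K; for larger K there is no such P_4. *)
Lemma p4_middle (a b c d : G) :
  a \notin K -> b \notin K -> c \notin K -> d \notin K -> induced_p4 a b c d ->
  exists2 k, k \in K & [/\ edge b k, edge c k & ~~ edge d k].
Proof.
move=> aK bK cK dK p4; move: K4; rewrite leq_eqVlt => /orP[/eqP K4'|K5].
  have avF : avoids G forbidden4_c5.
    by do 3!apply: avoids_cons => //; apply: omega_avoids; rewrite K4'.
  have [Ks [p [q [r [t [l [lC KsE us ts e]]]]]]] :=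
    covers_sound clK (esym K4') nbK covers_patterns4_c5 avF aK bK cK dK p4.
  rewrite inE in lC; rewrite (eqP lC) in ts.
  have : size Ks = 4 by have := congr1 size ts; rewrite /= size_tri => -[].
  case: Ks KsE us ts => [|k1 [|k2 [|k3 [|k4 [|]]]]] //= KsE us ts _.
  have k2K : k2 \in K by rewrite -KsE !inE eqxx orbT.
  case: ts; rewrite /bits /= => _ _ _ _ p2 _ _ _ _ _ q2 _ _ _ _ r2 _ _ _ t2 _ _.
  move=> *; exists k2 => //.
  by case: e => -[? ? ? ?]; subst; rewrite ?p2 ?q2 ?r2 ?t2.
have := omega_ge5_c5_free_p4_free dia p2p4 clK _ omK K5 c5.
have [[ab bc cd] [ac ad bd]] := p4.
move=> /(_ (ltnW K4))/(_ a b c d); rewrite !inE => /(_ aK bK cK dK ab bc cd ac bd).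
by rewrite (negbTE ad).
Qed.

(** The common neighbours in K of p 1, p 2 and of p 2, p 3 coincide, as p 2 has only one; but the
    first is missed by p 3. *)
Lemma no_p5 (p : nat -> G) :
  (forall j, j < 5 -> p j \notin K) ->
  (forall j k, j < k -> k < 5 -> edge (p j) (p k) = (k == j.+1)) -> False.
Proof.
move=> pK pE.
have [||||| k kK [k1 k2 k3]] := @p4_middle (p 0) (p 1) (p 2) (p 3); rewrite ?pK //.
  by split; split; rewrite pE.
have [||||| k' k'K [k1' k2' k3']] := @p4_middle (p 1) (p 2) (p 3) (p 4); rewrite ?pK //.
  by split; split; rewrite pE.
by case/negP: k3; rewrite (nbK (pK 2 isT) kK k'K).
Qed.

Lemma no_c7 : avoids G [:: cycle_rows 7].
Proof.
move=> s us; rewrite inE; apply/eqP => ts.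
have sz : size s = 7 by rewrite -size_tri ts.
have /card_gt0P[x0 x0K] : 0 < #|K| by apply: leq_trans K4.
have sE i j : i < 7 -> j < 7 ->
    edge (nth x0 s i) (nth x0 s j) = adj (square (cycle_rows 7)) i j.
  move=> hi hj; rewrite -ts /adj square_tri (nth_map x0) ?sz //.
  by rewrite (nth_map x0) ?sz.
pose v := [seq x \in K | x <- s].
have vE i : i < 7 -> nth false v i = (nth x0 s i \in K).
  by move=> hi; rewrite (nth_map x0) ?sz.
have vK : clique_bits v.
  apply/allP => i; rewrite mem_iota => /andP[_ hi]; apply/allP => j.
  rewrite mem_iota => /andP[_ hj]; rewrite !vE //; apply/implyP => /andP[iK jK].
  case: eqP => //= /eqP ij; rewrite -sE //; apply: (cliqueP _ clK) => //.
  by rewrite nth_uniq ?sz.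
have : v \in all_bits 7 by rewrite -sz -(size_map (mem K) s) mem_all_bits.
move/(allP clique_free_window); rewrite vK => /hasP[i]; rewrite mem_iota => /andP[_ hi].
move/allP=> free; apply: (@no_p5 (fun j => nth x0 s ((i + j) %% 7))) => [j hj|j k jk hk].
  by rewrite -vE ?ltn_mod // free // mem_iota.
have mi n m : m < n -> m \in iota 0 n by rewrite mem_iota.
have := allP (allP (allP window_adj i (mi _ _ hi)) j (mi _ _ (ltn_trans jk hk))) k (mi _ _ hk).
by rewrite jk sE ?ltn_mod //= => /eqP.
Qed.
End CycleSeven.

(** * Induced subgraphs, chi and omega *)

Lemma contains_embedding (G H : sgraph) (h : H -> G) :
  injective h -> (forall x y, edge (h x) (h y) = edge x y) -> contains G H.
Proof.
move=> hi hE; exists (h @: [set: H]).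
pose f (x : H) : induced (h @: [set: H]) := exist _ (h x) (imset_f h (in_setT x)).
exists f; split; last exact: hE.
apply: inj_card_bij; first by move=> x y [] /hi.
by rewrite card_sig -cardsT -(card_imset _ hi) subset_leq_card //; apply/subsetP.
Qed.

Lemma contains_copy (G H : sgraph) m (s : seq G) (e : H -> nat) :
  0 < size m -> injective e -> (forall x, e x < size m) ->
  (forall x y, edge x y = adj (square m) (e x) (e y)) ->
  uniq s -> tri s = m -> contains G H.
Proof.
move=> m0 ei el eE us ts; have sz : size s = size m by rewrite -ts size_tri.
case: s sz us ts => [|x0 s'] sz us ts; first by rewrite -sz in m0.
set s := x0 :: s' in sz us ts.
apply: (@contains_embedding G H (fun x => nth x0 s (e x))) => [x y /eqP|x y].
  by rewrite nth_uniq ?sz // => /eqP/ei.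
by rewrite eE -ts /adj square_tri (nth_map x0) ?sz // (nth_map x0) ?sz.
Qed.

Lemma avoids_p2p4_rows (G : sgraph) :
  ~ contains G (dunion (path_graph 2) (path_graph 4)) -> avoids G [:: p2p4_rows].
Proof.
move=> nc s us; rewrite inE; apply/eqP => ts; apply: nc.
pose e (x : dunion (path_graph 2) (path_graph 4)) : nat :=
  (* Positions of u, v and of a, b, c, d in [p2p4_rows]. *)
  match x with inl i => nth 0 [:: 1; 0] i | inr i => nth 0 [:: 3; 5; 4; 2] i end.
apply: (contains_copy (e := e) _ _ _ _ us ts) => //.
- move=> [[[|[|i]] //= hi]|[[|[|[|[|i]]]] //= hi]] [[[|[|j]] //= hj]|[[|[|[|[|j]]]] //= hj]] //= _;
    by congr (_ _); apply: val_inj.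
- by move=> [[[|[|i]] //= hi]|[[|[|[|[|i]]]] //= hi]].
- by move=> [[[|[|i]] //= hi]|[[|[|[|[|i]]]] //= hi]] [[[|[|j]] //= hj]|[[|[|[|[|j]]]] //= hj]].
Qed.

Lemma avoids_diamond_rows (G : sgraph) :
  ~ contains G K4_minus_edge -> avoids G [:: diamond_rows].
Proof.
move=> nc s us; rewrite inE; apply/eqP => ts; apply: nc.
(* The ends 0 and 3 of the deleted edge go to the two nonadjacent first positions of
   [diamond_rows]. *)
pose e (x : K4_minus_edge) : nat := nth 0 [:: 0; 2; 3; 1] (x : 'I_4).
apply: (contains_copy (e := e) _ _ _ _ us ts) => //.
- move=> [[|[|[|[|i]]]] //= hi] [[|[|[|[|j]]]] //= hj] //= _; exact: val_inj.
- by move=> [[|[|[|[|i]]]] //= hi].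
- move=> x y; rewrite /edge /= /delete_edge_rel eqEsubset !subUset !sub1set !inE.
  rewrite /edge /= -!val_eqE /=.
  by move: x y => [[|[|[|[|i]]]] //= hi] [[|[|[|[|j]]]] //= hj].
Qed.

Lemma contains_cycle (G : sgraph) n (s : seq G) :
  0 < n ->
  all (fun i => all (fun j =>
    ((i != j) && ((i.+1 == j %[mod n]) || (j.+1 == i %[mod n]))) ==
    adj (square (cycle_rows n)) i j) (iota 0 n)) (iota 0 n) ->
  uniq s -> tri s = cycle_rows n -> contains G (cycle_graph n).
Proof.
move=> n0 chk; have sz : size (cycle_rows n) = n.
  by rewrite size_rev size_map size_iota.
apply: (contains_copy (H := cycle_graph n) (e := @nat_of_ord n)); rewrite ?sz //.
  exact: val_inj.
move=> x y; have mi (i : 'I_n) : nat_of_ord i \in iota 0 n by rewrite mem_iota /=.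
by rewrite -(eqP (allP (allP chk _ (mi x)) _ (mi y))).
Qed.

Lemma avoids_induced (G : sgraph) (S : {set G}) F :
  avoids G F -> avoids (induced S) F.
Proof.
move=> av s us; have -> : tri s = tri [seq val x | x <- s].
  by elim: s {us} => //= x s ->; rewrite /bits -map_comp.
by apply: av; rewrite map_inj_uniq //; apply: val_inj.
Qed.

Lemma omega_clique (G : sgraph) :
  exists2 K : {set G}, clique K & #|K| = omega G.
Proof.
have [|K clK E] := @eq_bigmax_cond _ [pred S : {set G} | clique S] (fun S => #|S|).
  by apply/card_gt0P; exists set0; apply/cliqueP => x y; rewrite inE.
by exists K.
Qed.

Lemma clique_le_omega (G : sgraph) (S : {set G}) : clique S -> #|S| <= omega G.
Proof. by move=> clS; apply: (leq_bigmax_cond S). Qed.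

Lemma chi_le (G : sgraph) k : colourable_on [set: G] k -> chi G <= k.
Proof.
move=> [c [ck cc]]; rewrite /chi; case: ex_minnP => n _; apply.
have ck' x : c x < k by apply: ck.
apply/existsP; exists [ffun x => Ordinal (ck' x)].
apply/forallP => x; apply/forallP => y; apply/implyP => xy; rewrite !ffunE.
by rewrite -val_eqE /=; apply/eqP/cc.
Qed.

Lemma omega_le_chi (G : sgraph) : omega G <= chi G.
Proof.
have [K clK <-] := omega_clique G.
rewrite /chi; case: ex_minnP => n /existsP[c /forallP cP] _.
have ci : {in K &, injective c}.
  move=> x y xK yK e; apply/eqP/negPn/negP => xy.
  have /forallP/(_ y)/implyP := cP x.
  by rewrite e eqxx => h; have := h (cliqueP _ clK x y xK yK xy).
by rewrite -(card_in_imset ci) -[n in _ <= n]card_ord max_card.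
Qed.

Lemma chi_eq_omega (G : sgraph) : colourable_on [set: G] (omega G) -> chi G = omega G.
Proof. by move=> /chi_le h; apply/eqP; rewrite eqn_leq h omega_le_chi. Qed.

(** Clique number two gives a bipartite graph, and at most one gives no edges. The hypotheses pass
    to induced subgraphs, whence perfection. *)
Lemma c5_c7_free_chi (G : sgraph) :
  avoids G [:: diamond_rows] -> avoids G [:: p2p4_rows] ->
  avoids G [:: cycle_rows 5] -> avoids G [:: cycle_rows 7] -> chi G = omega G.
Proof.
move=> dia p2p4 c5 c7; have [K clK cK] := omega_clique G.
have om (S : {set G}) : clique S -> #|S| <= #|K|.
  by rewrite cK; apply: clique_le_omega.
apply: chi_eq_omega; rewrite -cK.
case: (leqP 3 #|K|) => [K3|]; first exact: c5_free_colourable.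
move Ew : #|K| => w; rewrite {}Ew in om; case: w om => [|[|[|//]]] om _.
- have G0 (x : G) : False by have := om [set x]; rewrite clique1 cards1 => /(_ isT).
  by exists (fun=> 0); split=> x; case: (G0 x).
- exists (fun=> 0); split=> // x y _ _ xy; have xny : x != y.
    by apply: contraTneq xy => ->; rewrite edge_irr.
  have cl : clique (x |: [set y]).
    by apply: cliqueU1 (clique1 y) => z; rewrite inE => /eqP->.
  by have := om _ cl; rewrite cards2 xny.
apply: bipartite; do 3!apply: avoids_cons => //.
exact: (omega_avoids om).
Qed.

Lemma avoids_not_contains_c5 (G : sgraph) :
  avoids G [:: cycle_rows 5] -> ~ contains G (cycle_graph 5).
Proof.
move=> av [S [f [/bij_inj fi fE]]].
pose o i (hi : i < 5) : cycle_graph 5 := Ordinal hi.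
have us := map_inj_uniq (inj_comp val_inj fi)
  [:: o 4 isT; o 3 isT; o 2 isT; o 1 isT; o 0 isT].
have fE' x y : edge (val (f x)) (val (f y)) = edge x y by rewrite -fE.
by have := av _ (etrans us isT); rewrite /= /bits /= !fE'.
Qed.

Theorem theorem1p2 (G : sgraph)
  (Gfree : free_of [:: dunion (path_graph 2) (path_graph 4); K4_minus_edge] G)
  (Gomega : 3 <= omega G) :
  perfect G
  \/ (contains G (cycle_graph 5) /\ (chi G <= 6 \/ chi G = omega G))
  \/ (free_of [:: cycle_graph 5] G /\ contains G (cycle_graph 7) /\ chi G <= 3).
Proof.
have p2p4 := avoids_p2p4_rows (List.Forall_inv Gfree).
have dia := avoids_diamond_rows (List.Forall_inv (List.Forall_inv_tail Gfree)).
have [K clK cK] := omega_clique G.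
have om (S : {set G}) : clique S -> #|S| <= #|K|.
  by rewrite cK; apply: clique_le_omega.
rewrite -cK in Gomega.
have [[s us ts]|c5] := copy_or_avoids G (cycle_rows 5).
  right; left; split; first by apply: contains_cycle us ts.
  case: (ltnP #|K| 6) => [K6|K6]; last first.
    right; apply: chi_eq_omega; rewrite -cK.
    exact: omega_ge6_colourable.
  left; apply: chi_le; have : #|K| \in [:: 3; 4; 5].
    by rewrite !inE; move: Gomega K6; case: #|K| => [|[|[|[|[|[|]]]]]].
  rewrite !inE => /or3P[] /eqP cK'.
  - by apply: (omega3_colourable (K := K)); rewrite // -cK'.
  - exact: omega4_colourable dia p2p4 clK Gomega om cK'.
  - exact: omega5_colourable dia p2p4 clK Gomega om cK'.
have [[s us ts]|c7] := copy_or_avoids G (cycle_rows 7).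
  right; right; split; first by constructor; [apply: avoids_not_contains_c5|].
  split; first by apply: contains_cycle us ts.
  case: (ltnP 3 #|K|) => K3.
    by have := no_c7 dia p2p4 c5 clK K3 om us; rewrite ts inE eqxx.
  have cK3 : #|K| = 3 by apply/eqP; rewrite eqn_leq K3.
  apply: chi_le; exact: omega3_c5_free_colourable dia p2p4 clK Gomega om cK3 c5.
by left=> S; apply: c5_c7_free_chi; apply: avoids_induced.
Qed.
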